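(* Let $A\in\mathbb{R}^{m\times n}$. The following hold. (i) For all $(\lambda,b)\in\mathbb{R}_+\times\mathbb{R}^m$ (i.e. $(\lambda,b,A)\in\operatorname{dom}S$) and all $(I^+,I^0,I^-)\in\mathcal{K}(\lambda,b,A)$, $$S(\lambda,b,A)=\left\{x\in\mathbb{R}^n\ \left|\ \begin{array}{lll}x_i\ge0,& A_i^\top(b-Ax)=\lambda&\forall i\in I^+\\ x_i=0,&|A_i^\top(b-Ax)|\le\lambda&\forall i\in I^0\\ x_i\le0,&A_i^\top(b-Ax)=-\lambda&\forall i\in I^-\end{array}\right.\right\}.$$ (ii) If $(I^+,I^0,I^-)\in\mathcal{J}^0(A)$, then $S(\cdot,\cdot,A)$ is single-valued and linear on $P_{1,2}(\mathbb{G}(A,(I^+,I^0,I^-)))$, with $S(\lambda,b,A)=\{x\}$ for all $(\lambda,b)\in P_{1,2}(\mathbb{G}(A,(I^+,I^0,I^-)))$, where $x$ is the unique solution to the system of linear equations $$A_i^\top Ax=A_i^\top b-\lambda\ \ \forall i\in I^+,\qquad x_i=0\ \ \forall i\in I^0,\qquad A_i^\top Ax=A_i^\top b+\lambda\ \ \forall i\in I^-.$$ If $(I^+,I^0,I^-)\in\mathcal{J}(A)\setminus\mathcal{J}^0(A)$, then $S(\cdot,\cdot,A)$ is not single-valued on $\operatorname{int}P_{1,2}(\mathbb{G}(A,(I^+,I^0,I^-)))$. (iii) If $S$ is single-valued at $(\lambda,b,A)$ with $S(\lambda,b,A)=\{x\}$, then $(I^+(x),I^0(x),I^-(x))\in\mathcal{K}(\lambda,b,A)\cap\mathcal{J}^0(A)$.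 (iv) For any distinct index partitions $(I^+,I^0,I^-)$ and $(\bar I^+,\bar I^0,\bar I^-)$ in $\mathcal{J}(A)$ and any $(\lambda,b,x),(\lambda',b',x')\in\operatorname{gph}S(\cdot,\cdot,A)$ such that $(\lambda,b)\in\operatorname{int}P_{1,2}(\mathbb{G}(A,(I^+,I^0,I^-)))$ and $(\lambda',b')\in\operatorname{int}P_{1,2}(\mathbb{G}(A,(\bar I^+,\bar I^0,\bar I^-)))$, there is some $\theta\in(0,1)$ such that $$\theta(\lambda,b,x)+(1-\theta)(\lambda',b',x')\notin\operatorname{gph}S(\cdot,\cdot,A).$$
   Context: Notation: $\mathbb{R}_+=[0,\infty)$; $\|\cdot\|$ is the Euclidean norm, $\|\cdot\|_1$ the $\ell_1$-norm; $A_i$ is the $i$th column of $A$ and $A_K$ the submatrix of columns indexed by $K$; $\operatorname{rge}A$ is the range of $A$ and $\operatorname{proj}_{\operatorname{rge}A}b$ the Euclidean projection of $b$ onto it; $\operatorname{gph}G=\{(z,x)\mid x\in G(z)\}$ and $\operatorname{dom}G=\{z\mid G(z)\neq\emptyset\}$ for a multifunction $G$; $\operatorname{int}$ is interior. Solution multifunction $S:\mathbb{R}\times\mathbb{R}^m\times\mathbb{R}^{m\times n}\rightrightarrows\mathbb{R}^n$: if $\lambda>0$, $S(\lambda,b,A)$ is the set of minimizers over $x\in\mathbb{R}^n$ of $\frac{1}{2\lambda}\|Ax-\operatorname{proj}_{\operatorname{rge}A}b\|^2+\|x\|_1$ (equivalently of $\frac12\|Ax-b\|^2+\lambda\|x\|_1$);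 if $\lambda=0$, $S(0,b,A)$ is the set of minimizers of $\|x\|_1$ subject to $Ax=\operatorname{proj}_{\operatorname{rge}A}b$; if $\lambda<0$, $S(\lambda,b,A)=\emptyset$. Index partitions: $I=\{1,\dots,n\}$ and $\mathcal{I}$ is the set of all triples $(I^+,I^0,I^-)$ of pairwise disjoint (possibly empty) subsets of $I$ whose union is $I$. For $x\in\mathbb{R}^n$, $I^+(x)=\{i\mid x_i>0\}$, $I^0(x)=\{i\mid x_i=0\}$, $I^-(x)=\{i\mid x_i<0\}$. $\mathcal{J}(A)$ is the set of $(I^+,I^0,I^-)\in\mathcal{I}$ for which there is $y\in\mathbb{R}^m$ with $A_i^\top y=1$ for $i\in I^+$, $|A_i^\top y|<1$ for $i\in I^0$, $A_i^\top y=-1$ for $i\in I^-$. $\mathcal{J}^0(A)$ is the set of $(I^+,I^0,I^-)\in\mathcal{J}(A)$ such that either $I^+\cup I^-=\emptyset$ or $\operatorname{rank}A_{I^+\cup I^-}=|I^+\cup I^-|$. For $(I^+,I^0,I^-)\in\mathcal{I}$, $\mathbb{G}(A,(I^+,I^0,I^-))$ is the polyhedral cone of all $(\lambda,b,x)\in\mathbb{R}_+\times\mathbb{R}^m\times\mathbb{R}^n$ such that $x_i\ge0,\ A_i^\top(b-Ax)=\lambda$ for $i\in I^+$; $x_i=0,\ |A_i^\top(b-Ax)|\le\lambda$ for $i\in I^0$; $x_i\le0,\ A_i^\top(b-Ax)=-\lambda$ for $i\in I^-$. $P_{1,2}$ is the projection $(\lambda,b,x)\mapsto(\lambda,b)$.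 $\mathcal{K}(\lambda,b,A)=\{(I^+,I^0,I^-)\in\mathcal{J}(A)\mid(\lambda,b)\in P_{1,2}(\mathbb{G}(A,(I^+,I^0,I^-)))\}$. A single-valued mapping is linear on a set $D$ if it coincides on $D$ with a linear map (of the form $z\mapsto Bz$ for a matrix $B$). *)

(* Defs.v *)
From HB Require Import structures.
From mathcomp Require Import all_boot all_order all_algebra.
From mathcomp Require Import all_classical all_reals all_analysis.

Set Implicit Arguments.
Unset Strict Implicit.
Unset Printing Implicit Defensive.

Import Order.TTheory GRing.Theory Num.Theory.
Import numFieldNormedType.Exports.

Local Open Scope classical_set_scope.
Local Open Scope ring_scope.

(* The library norm on matrices is the sup norm, hence these two. *)
Definition norm2 (R : realType) (k : nat) (v : 'cV[R]_k) : R :=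
  Num.sqrt (\sum_(i < k) v i 0 ^+ 2).

Definition norm1 (R : realType) (k : nat) (v : 'cV[R]_k) : R :=
  \sum_(i < k) `|v i 0|.

Definition argmin (R : realType) (T : Type) (D : set T) (f : T -> R) : set T :=
  [set x | D x /\ forall y, D y -> f x <= f y].

Definition rge (R : realType) (m n : nat) (A : 'M[R]_(m, n)) : set 'cV[R]_m :=
  range (fun x : 'cV[R]_n => A *m x).

(* [xget] only falls back on its default [0] when there is no nearest point;
   this never happens for [C = rge A], see [proj_rgeP]. *)
Definition proj (R : realType) (m : nat) (C : set 'cV[R]_m) (b : 'cV[R]_m) :
    'cV[R]_m :=
  xget 0 (argmin C (fun p => norm2 (b - p))).

Lemma dotmx_ge0 (R : realType) (k : nat) (u : 'cV[R]_k) : 0 <= (u^T *m u) 0 0.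
Proof.
rewrite mxE; apply: sumr_ge0 => i _.
by rewrite mxE -expr2 sqr_ge0.
Qed.

Lemma dotmx_eq0 (R : realType) (k : nat) (u : 'cV[R]_k) :
  u^T *m u = 0 -> u = 0.
Proof.
move=> /matrixP /(_ 0 0); rewrite !mxE => /eqP.
rewrite psumr_eq0 => [/allP h|i _]; last by rewrite mxE -expr2 sqr_ge0.
apply/matrixP => i j; rewrite ord1 [RHS]mxE.
have /(_ (mem_index_enum i)) := h i.
by rewrite /= mxE -expr2 sqrf_eq0 => /eqP.
Qed.

Lemma norm2E (R : realType) (k : nat) (u : 'cV[R]_k) :
  norm2 u = Num.sqrt ((u^T *m u) 0 0).
Proof.
by rewrite /norm2 mxE; congr Num.sqrt; apply: eq_bigr => i _; rewrite mxE expr2.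
Qed.

Lemma normal_equation (R : realType) (m n : nat) (A : 'M[R]_(m, n))
    (b : 'cV[R]_m) : exists x : 'cV[R]_n, A^T *m (b - A *m x) = 0.
Proof.
have sub : (A <= A^T *m A)%MS.
  rewrite submxE; apply/eqP; set C := cokermx _.
  have C0 : A^T *m A *m C = 0 by exact: mulmx_coker.
  suff h j : col j (A *m C) = 0.
    by apply/matrixP => i j; have /matrixP/(_ i 0) := h j; rewrite !mxE.
  apply: dotmx_eq0; rewrite colE; set d := delta_mx _ _.
  have -> : (A *m C *m d)^T *m (A *m C *m d) =
      (C *m d)^T *m (A^T *m A *m C) *m d by rewrite !trmx_mul !mulmxA.
  by rewrite C0 mulmx0 mul0mx.
have [D AE] := submxP sub.
exists (D^T *m b); rewrite mulmxBr mulmxA mulmxA.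
rewrite {1}AE trmx_mul trmx_mul trmxK -!mulmxA.
by apply/eqP; rewrite subr_eq0; apply/eqP; rewrite !mulmxA.
Qed.

Lemma proj_rgeP (R : realType) (m n : nat) (A : 'M[R]_(m, n)) (b : 'cV[R]_m) :
  argmin (rge A) (fun p => norm2 (b - p)) (proj (rge A) b).
Proof.
rewrite /proj; case: xgetP => [//|nope]; exfalso.
have [x hx] := normal_equation A b.
apply: (nope (A *m x)); split; first by exists x.
move=> _ [y _ <-]; rewrite !norm2E ler_sqrt ?dotmx_ge0 //.
have -> : b - A *m y = (b - A *m x) + A *m (x - y).
  by rewrite mulmxBr addrA subrK.
move: (b - A *m x) (x - y) hx => r w hr.
have rs : (A *m w)^T *m r = 0 by rewrite trmx_mul -mulmxA hr mulmx0.
have sr : r^T *m (A *m w) = 0 by apply: trmx_inj; rewrite trmx_mul trmxK rs trmx0.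
have -> : (r + A *m w)^T = r^T + (A *m w)^T by exact: raddfD.
rewrite mulmxDl !mulmxDr rs sr addr0 add0r [leRHS]mxE.
by rewrite lerDl dotmx_ge0.
Qed.

Definition solS (R : realType) (m n : nat) (lambda : R) (b : 'cV[R]_m)
    (A : 'M[R]_(m, n)) : set 'cV[R]_n :=
  if 0 < lambda then
    argmin setT (fun x => (2 * lambda)^-1 *
      norm2 (A *m x - proj (rge A) b) ^+ 2 + norm1 x)
  else if lambda == 0 then
    argmin [set x | A *m x = proj (rge A) b] (@norm1 R n)
  else set0.

(* S(., ., A) *)
Definition solS_slice (R : realType) (m n : nat) (A : 'M[R]_(m, n)) :
    R * 'cV[R]_m -> set 'cV[R]_n :=
  fun z => solS z.1 z.2 A.

Definition gph (T U : Type) (F : T -> set U) : set (T * U) :=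
  [set w | F w.1 w.2].

Definition single_valued_at (T U : Type) (F : T -> set U) (z : T) : Prop :=
  exists x, F z = [set x].

Definition single_valued_on (T U : Type) (F : T -> set U) (D : set T) : Prop :=
  forall z, D z -> single_valued_at F z.

Definition linear_on (R : realType) (m n : nat)
    (F : R * 'cV[R]_m -> set 'cV[R]_n) (D : set (R * 'cV[R]_m)) : Prop :=
  exists B : 'M[R]_(n, 1 + m),
    forall z, D z -> F z = [set B *m col_mx z.1%:M z.2].

Record index_triple (n : nat) := IndexTriple {
  Ipos : {set 'I_n};
  Izero : {set 'I_n};
  Ineg : {set 'I_n}
}.

Definition calI (n : nat) : set (index_triple n) :=
  [set p | [/\ [disjoint Ipos p & Izero p]%B, [disjoint Ipos p & Ineg p]%B,
    [disjoint Izero p & Ineg p]%B &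
    (Ipos p :|: Izero p :|: Ineg p)%SET = [set: 'I_n]%SET]].

Definition sign_partition (R : realType) (n : nat) (x : 'cV[R]_n) :
    index_triple n :=
  IndexTriple [set i | 0 < x i 0]%SET [set i | x i 0 == 0]%SET
    [set i | x i 0 < 0]%SET.

(* [coldot A i v] is A_i^T v, with A_i the [i]th column of [A]. *)
Definition coldot (R : realType) (m n : nat) (A : 'M[R]_(m, n)) (i : 'I_n)
    (v : 'cV[R]_m) : R :=
  ((col i A)^T *m v) 0 0.

Definition cols (R : realType) (m n : nat) (A : 'M[R]_(m, n))
    (K : {set 'I_n}) : 'M[R]_(m, #|K|) :=
  colsub (fun k : 'I_#|K| => enum_val k) A.

Definition calJ (R : realType) (m n : nat) (A : 'M[R]_(m, n)) :
    set (index_triple n) :=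
  [set p | calI p /\ exists y : 'cV[R]_m,
    [/\ forall i, i \in Ipos p -> coldot A i y = 1,
        forall i, i \in Izero p -> `|coldot A i y| < 1 &
        forall i, i \in Ineg p -> coldot A i y = -1]].

Definition calJ0 (R : realType) (m n : nat) (A : 'M[R]_(m, n)) :
    set (index_triple n) :=
  [set p | calJ A p /\
    let K := (Ipos p :|: Ineg p)%SET in K = finset.set0 \/ \rank (cols A K) = #|K|].

Definition optimality_system (R : realType) (m n : nat) (A : 'M[R]_(m, n))
    (p : index_triple n) (lambda : R) (b : 'cV[R]_m) : set 'cV[R]_n :=
  [set x : 'cV[R]_n |
    [/\ forall i, i \in Ipos p ->
          0 <= x i 0 /\ coldot A i (b - A *m x) = lambda,
        forall i, i \in Izero p ->
          x i 0 = 0 /\ `|coldot A i (b - A *m x)| <= lambda &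
        forall i, i \in Ineg p ->
          x i 0 <= 0 /\ coldot A i (b - A *m x) = - lambda]].

Definition linear_system (R : realType) (m n : nat) (A : 'M[R]_(m, n))
    (p : index_triple n) (lambda : R) (b : 'cV[R]_m) : set 'cV[R]_n :=
  [set x : 'cV[R]_n |
    [/\ forall i, i \in Ipos p ->
          coldot A i (A *m x) = coldot A i b - lambda,
        forall i, i \in Izero p -> x i 0 = 0 &
        forall i, i \in Ineg p ->
          coldot A i (A *m x) = coldot A i b + lambda]].

Definition bbG (R : realType) (m n : nat) (A : 'M[R]_(m, n))
    (p : index_triple n) : set (R * 'cV[R]_m * 'cV[R]_n) :=
  [set w | 0 <= w.1.1 /\ optimality_system A p w.1.1 w.1.2 w.2].

Definition P12 (R : realType) (m n : nat) (G : set (R * 'cV[R]_m * 'cV[R]_n)) :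
    set (R * 'cV[R]_m) :=
  fst @` G.

Definition calK (R : realType) (m n : nat) (lambda : R) (b : 'cV[R]_m)
    (A : 'M[R]_(m, n)) : set (index_triple n) :=
  [set p | calJ A p /\ P12 (bbG A p) (lambda, b)].

(* Main.v *)
Require Import Defs.
From HB Require Import structures.
From mathcomp Require Import all_boot all_order all_algebra.
From mathcomp Require Import all_classical all_reals all_analysis.
From mathcomp Require Import ring lra.

Set Implicit Arguments.
Unset Strict Implicit.
Unset Printing Implicit Defensive.

Import Order.TTheory GRing.Theory Num.Theory.
Import numFieldNormedType.Exports.

Local Open Scope classical_set_scope.
Local Open Scope ring_scope.

(** The solution set of the problem with data [lambda], [b] is governed by dual
    certificates.  If [x0] satisfies the optimality conditions with multiplier
    [y], that is [A^T (b - A x0) = lambda A^T y], [|A_i^T y| <= 1] and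
    [x0_i A_i^T y = |x0_i|], then, for positive [lambda], the objective
    exceeds its value at [x0] by the sum of the nonnegative terms
    [|A (x - x0)|^2 / (2 lambda)] and [|x|_1 - y^T A x].  Hence the solutions
    are exactly the [x] with [A x = A x0] which [y] certifies too; the same
    description holds for [lambda = 0] ([solS_certificate]).  It follows that
    every vector that certifies one solution certifies all the others
    ([certificate_transfer]).  For a partition in [calJ A], the strictly
    feasible [y] in its definition may therefore replace the multiplier, and
    what [y] certifies is exactly the sign pattern of the partition: this is
    [solS_piece], from which the other parts follow.

    When the active columns are independent, the optimality system determines
    its solution through one square invertible matrix ([full_rank_piece]).
    When they are not, any point of the interior of a piece has a solution
    whose active entries are all nonzero, and that solution can be moved in the
    kernel of the active columns ([interior_strict_point], [system_move]).

    If [x] is the only solution, it is the only minimizer of the l1 norm on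
    [x + ker A], so the directional derivative of the norm at [x] is positive
    on [ker A] minus the origin.  A multiplier which is strict off the support
    of [x] is then obtained without separation theorems: replace [|t|] by
    [sqrt (1 + t^2)] off the support; the resulting smooth function is coercive
    on [ker A], has a minimizer, and its gradient there is orthogonal to
    [ker A], hence of the form [A^T y]; its entries off the support are values
    of the derivative of [sqrt (1 + t^2)] and so lie strictly between [-1] and
    [1] ([strict_certificate]).

    Finally, if a whole segment lies in the graph, the optimality conditions
    near one end force the multiplier of the other end to certify the first
    solution ([segment_certificate]).  At an interior point of a piece some
    solution has full sign pattern, so the active sets of the two partitions
    contain each other ([segment_subpartition]). *)

(** * Inner products, columns and the projection onto the range *)

Definition dot (R : realType) (k : nat) (u v : 'cV[R]_k) : R :=
  (u^T *m v) 0 0.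

Lemma dotE (R : realType) (k : nat) (u v : 'cV[R]_k) :
  dot u v = \sum_(i < k) u i 0 * v i 0.
Proof. by rewrite /dot mxE; apply: eq_bigr => i _; rewrite mxE. Qed.

Lemma dotC (R : realType) (k : nat) (u v : 'cV[R]_k) : dot u v = dot v u.
Proof. by rewrite !dotE; apply: eq_bigr => i _; rewrite mulrC. Qed.

Lemma dotDr (R : realType) (k : nat) (u v w : 'cV[R]_k) :
  dot u (v + w) = dot u v + dot u w.
Proof. by rewrite /dot mulmxDr mxE. Qed.

Lemma dotZr (R : realType) (k : nat) (a : R) (u v : 'cV[R]_k) :
  dot u (a *: v) = a * dot u v.
Proof. by rewrite /dot -scalemxAr mxE. Qed.

Lemma dotNr (R : realType) (k : nat) (u v : 'cV[R]_k) :
  dot u (- v) = - dot u v.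
Proof. by rewrite /dot mulmxN mxE. Qed.

Lemma dot0r (R : realType) (k : nat) (u : 'cV[R]_k) : dot u 0 = 0.
Proof. by rewrite /dot mulmx0 mxE. Qed.

Lemma dotBr (R : realType) (k : nat) (u v w : 'cV[R]_k) :
  dot u (v - w) = dot u v - dot u w.
Proof. by rewrite dotDr dotNr. Qed.

Lemma dotBl (R : realType) (k : nat) (u v w : 'cV[R]_k) :
  dot (v - w) u = dot v u - dot w u.
Proof. by rewrite !(dotC _ u) dotBr. Qed.

Lemma dotZl (R : realType) (k : nat) (a : R) (u v : 'cV[R]_k) :
  dot (a *: v) u = a * dot v u.
Proof. by rewrite !(dotC _ u) dotZr. Qed.

Lemma dot_ge0 (R : realType) (k : nat) (u : 'cV[R]_k) : 0 <= dot u u.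
Proof. exact: dotmx_ge0. Qed.

Lemma dot_eq0 (R : realType) (k : nat) (u : 'cV[R]_k) : dot u u = 0 -> u = 0.
Proof.
move=> u0; apply: dotmx_eq0; apply/matrixP => i j.
by rewrite !ord1 -[LHS]/(dot u u) u0 mxE.
Qed.

Lemma norm2_sqr (R : realType) (k : nat) (u : 'cV[R]_k) :
  norm2 u ^+ 2 = dot u u.
Proof. by rewrite norm2E sqr_sqrtr // dotmx_ge0. Qed.

Section Columns.
Context (R : realType) (m n : nat) (A : 'M[R]_(m, n)).

Lemma coldotE i v : coldot A i v = dot (col i A) v.
Proof. by []. Qed.

Lemma coldot_tr i v : coldot A i v = (A^T *m v) i 0.
Proof. by rewrite coldotE dotE mxE; apply: eq_bigr => k _; rewrite !mxE. Qed.

Lemma coldotD i v w : coldot A i (v + w) = coldot A i v + coldot A i w.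
Proof. exact: dotDr. Qed.

Lemma coldotB i v w : coldot A i (v - w) = coldot A i v - coldot A i w.
Proof. exact: dotBr. Qed.

Lemma coldotZ i a v : coldot A i (a *: v) = a * coldot A i v.
Proof. exact: dotZr. Qed.

Lemma dot_range (v : 'cV_m) (x : 'cV_n) :
  dot v (A *m x) = \sum_i coldot A i v * x i 0.
Proof.
rewrite /dot mulmxA mxE; apply: eq_bigr => i _; congr (_ * _).
by rewrite coldot_tr -[in RHS](trmxK v) -trmx_mul [RHS]mxE.
Qed.

Lemma coldot_ker v : (forall i, coldot A i v = 0) -> forall x, dot v (A *m x) = 0.
Proof. by move=> v0 x; rewrite dot_range big1 // => i _; rewrite v0 mul0r. Qed.

Lemma range_normal_eq0 x : (forall i, coldot A i (A *m x) = 0) -> A *m x = 0.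
Proof. by move=> x0; apply: dot_eq0; apply: coldot_ker. Qed.

End Columns.

(** Only the normal equations of the projection are used below: they give
    [A^T (proj b) = A^T b], so that [b] may replace its projection in every
    optimality condition. *)
Lemma proj_normal (R : realType) (m n : nat) (A : 'M[R]_(m, n)) (b : 'cV[R]_m) :
  exists2 x : 'cV_n, Defs.proj (rge A) b = A *m x &
    forall i, coldot A i (b - Defs.proj (rge A) b) = 0.
Proof.
have [[x _ xE] xmin] := proj_rgeP A b.
have [z zN] := normal_equation A b.
have zn i : coldot A i (b - A *m z) = 0 by rewrite coldot_tr zN mxE.
exists x; first by rewrite xE.
suff -> : Defs.proj (rge A) b = A *m z by [].
have := xmin (A *m z) (ex_intro2 _ _ z I erefl).
rewrite -xE -ler_sqr ?nnegrE ?sqrtr_ge0 // !norm2_sqr => le_xz.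
apply/eqP; rewrite -subr_eq0 -mulmxBr; apply/eqP/dot_eq0.
have E : b - A *m x = (b - A *m z) - A *m (x - z).
  by rewrite mulmxBr opprB addrA subrK.
have orth : dot (b - A *m z) (A *m (x - z)) = 0 by exact: coldot_ker.
move: le_xz orth (dot_ge0 (A *m (x - z))); rewrite E.
move: (b - _) (A *m (x - z)) => r w; rewrite dotBl !dotBr (dotC w r); lra.
Qed.

Lemma coldot_proj (R : realType) (m n : nat) (A : 'M[R]_(m, n)) (b : 'cV[R]_m) i v :
  coldot A i (Defs.proj (rge A) b - v) = coldot A i (b - v).
Proof.
have [_ _ /(_ i)] := proj_normal A b.
by rewrite !coldotB => /eqP; rewrite subr_eq0 => /eqP ->.
Qed.

Lemma eq_projP (R : realType) (m n : nat) (A : 'M[R]_(m, n)) (b : 'cV[R]_m) x :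
  A *m x = Defs.proj (rge A) b <-> forall i, coldot A i (b - A *m x) = 0.
Proof.
have [z zE zN] := proj_normal A b; split=> [->//|xN].
apply/eqP; rewrite zE -subr_eq0 -mulmxBr; apply/eqP/range_normal_eq0 => i.
have := zN i; have := xN i; rewrite zE mulmxBr !coldotB; lra.
Qed.

(** A quadratic vanishing at 0 and nonnegative just to the right of 0 cannot have
    negative slope at 0. *)
Lemma slope_le0 (R : realType) (q c delta : R) : 0 <= q -> 0 < delta ->
  (forall t, 0 < t -> t <= delta -> 0 <= q * t ^+ 2 - c * t) -> c <= 0.
Proof.
move=> q0 d0 h; rewrite leNgt; apply/negP => c0.
have q1 : 0 < q + 1 by lra.
pose t := Num.min delta (c / (q + 1)).
have t0 : 0 < t by rewrite lt_min d0 divr_gt0.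
have := h t t0; rewrite ge_min lexx /= => /(_ isT).
rewrite expr2 mulrA -mulrBl pmulr_lge0 // subr_ge0.
have : t * (q + 1) <= c by rewrite -ler_pdivlMr // ge_min lexx orbT.
lra.
Qed.

(** * Certificates and optimality conditions *)

(** [A^T y] is a subgradient of the l1 norm at [x]. *)
Definition certificate (R : realType) (m n : nat) (A : 'M[R]_(m, n))
    (x : 'cV[R]_n) (y : 'cV[R]_m) : Prop :=
  forall i, `|coldot A i y| <= 1 /\ coldot A i y * x i 0 = `|x i 0|.

Section Certificates.
Context (R : realType) (m n : nat) (A : 'M[R]_(m, n)).
Implicit Types (x d : 'cV[R]_n) (b y : 'cV[R]_m) (lambda : R).

(** The equality case, coordinate by coordinate, is what makes certificates
    equivalent to one scalar equation in [certificateP]. *)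
Lemma dual_le_norm1 x y : (forall i, `|coldot A i y| <= 1) ->
  dot y (A *m x) <= norm1 x ?= iff [forall i, coldot A i y * x i 0 == `|x i 0|].
Proof.
move=> y1; rewrite dot_range /norm1; apply: leif_sum => i _; apply/leifP.
case: ifPn => [/eqP //|neq]; rewrite lt_neqAle neq /=.
by apply: le_trans (ler_norm _) _; rewrite normrM ler_piMl.
Qed.

Lemma certificateP x y : (forall i, `|coldot A i y| <= 1) ->
  certificate A x y <-> norm1 x = dot y (A *m x).
Proof.
move=> y1; split=> [cxy|/esym/eqP].
  apply/esym/eqP; rewrite (dual_le_norm1 x y1).
  by apply/forallP => i; apply/eqP; case: (cxy i).
rewrite (dual_le_norm1 x y1) => /forallP xy i.
by split=> //; apply/eqP.
Qed.

(** By [certificateP] the norms of [x] and [x'] agree, being both equal to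
    [dot y (A *m x)]; so [y'] attains the norm of [x'] as soon as it attains that
    of [x]. *)
Lemma certificate_transfer x x' y y' : A *m x = A *m x' ->
  certificate A x y -> certificate A x' y -> certificate A x y' ->
  certificate A x' y'.
Proof.
move=> Axx' c1 c2 c3.
have y1 i : `|coldot A i y| <= 1 by case: (c1 i).
have y'1 i : `|coldot A i y'| <= 1 by case: (c3 i).
apply/certificateP => //; rewrite -Axx'.
move/(certificateP _ y1): c1 => c1; move/certificateP: c2 => /(_ y1) c2.
by move/certificateP: c3 => /(_ y'1) <-; rewrite c2 c1 Axx'.
Qed.

Definition lasso_obj lambda b x : R :=
  (2 * lambda)^-1 * norm2 (A *m x - Defs.proj (rge A) b) ^+ 2 + norm1 x.

(** The cross term of the expanded square involves only [A^T] of the residual, where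
    the projection can be replaced by [b]. *)
Lemma lasso_objD lambda b x d : 0 < lambda ->
  lasso_obj lambda b (x + d) = lasso_obj lambda b x
    + (2 * lambda)^-1 * dot (A *m d) (A *m d)
    - lambda^-1 * dot (b - A *m x) (A *m d) + (norm1 (x + d) - norm1 x).
Proof.
move=> lpos; rewrite /lasso_obj !norm2_sqr; set c := Defs.proj _ _.
have -> : dot (b - A *m x) (A *m d) = dot (c - A *m x) (A *m d).
  by rewrite !dot_range; apply: eq_bigr => i _; rewrite coldot_proj.
have -> : A *m (x + d) - c = A *m d - (c - A *m x).
  by rewrite mulmxDr opprB addrA [A *m d + _]addrC.
have -> : A *m x - c = - (c - A *m x) by rewrite opprB.
move: (A *m d) (c - _) => u r.
rewrite (dotNr (- r)) (dotC (- r)) dotNr dotBl !dotBr (dotC u r).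
by field; lra.
Qed.

Lemma solS_ge0 lambda b x : solS lambda b A x -> 0 <= lambda.
Proof. by rewrite /solS; case: ltgtP => // ->. Qed.

Lemma solS_gt0 lambda b : 0 < lambda ->
  solS lambda b A = argmin setT (lasso_obj lambda b).
Proof. by rewrite /solS => ->. Qed.

Lemma solS_0 b :
  solS 0 b A = argmin [set x | A *m x = Defs.proj (rge A) b] (@norm1 R n).
Proof. by rewrite /solS ltxx eqxx. Qed.

(** For positive [lambda] the objective exceeds its value at [x] by
    [|A (x' - x)|^2 / (2 lambda) + (norm1 x' - dot y (A *m x'))], a sum of two
    nonnegative terms which must both vanish at a minimizer.  For [lambda = 0] the
    first term is replaced by the constraint. *)
Lemma solS_certificate lambda b x y : 0 <= lambda -> certificate A x y ->
  (forall i, coldot A i (b - A *m x) = lambda * coldot A i y) ->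
  solS lambda b A = [set x' | A *m x' = A *m x /\ certificate A x' y].
Proof.
rewrite le_eqVlt => /predU1P[<-|lpos] cxy rxy.
  have Ax : A *m x = Defs.proj (rge A) b.
    by apply/eq_projP => i; rewrite rxy mul0r.
  have y1 i : `|coldot A i y| <= 1 by case: (cxy i).
  have xE : norm1 x = dot y (A *m x) by apply/certificateP.
  have low z : A *m z = Defs.proj (rge A) b -> norm1 x <= norm1 z.
    by move=> Az; rewrite xE Ax -Az; case: (dual_le_norm1 z y1).
  rewrite solS_0 -Ax; apply/seteqP; split=> z [/= Az].
    move=> /(_ x erefl) zx; split=> //; apply/certificateP => //.
    by rewrite Az -xE; apply/eqP; rewrite eq_le zx low // Az.
  move=> /(certificateP _ y1) zE; split=> // w Aw.
  by rewrite zE Az -xE low // Aw.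
have y1 i : `|coldot A i y| <= 1 by case: (cxy i).
have xE : norm1 x = dot y (A *m x) by apply/certificateP.
have gap z : lasso_obj lambda b z = lasso_obj lambda b x +
    ((2 * lambda)^-1 * dot (A *m (z - x)) (A *m (z - x)) +
     (norm1 z - dot y (A *m z))).
  rewrite -{1}(subrK x z) addrC lasso_objD //.
  have -> : dot (b - A *m x) (A *m (z - x)) = lambda * dot y (A *m (z - x)).
    by rewrite !dot_range mulr_sumr; apply: eq_bigr => i _; rewrite rxy mulrA.
  rewrite mulrA mulVf ?lt0r_neq0 // mul1r [x + (z - x)]addrC subrK.
  by rewrite [in dot y _]mulmxBr dotBr -xE; ring.
have q0 z : 0 <= (2 * lambda)^-1 * dot (A *m (z - x)) (A *m (z - x)).
  by rewrite mulr_ge0 ?dot_ge0 // invr_ge0; lra.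
have n0 z : 0 <= norm1 z - dot y (A *m z).
  by rewrite subr_ge0; case: (dual_le_norm1 z y1).
rewrite solS_gt0 //; apply/seteqP; split=> z /=.
  move=> [_ /(_ x I)]; rewrite gap => zx.
  have [q nz] : (2 * lambda)^-1 * dot (A *m (z - x)) (A *m (z - x)) = 0 /\
      norm1 z - dot y (A *m z) = 0.
    by have := q0 z; have := n0 z; split; lra.
  split; last by apply/certificateP => //; lra.
  move/eqP: q; rewrite mulf_eq0 gt_eqF /= ?invr_gt0; last by lra.
  move=> /eqP/dot_eq0/eqP; rewrite mulmxBr subr_eq0 => /eqP; exact.
move=> [Az /(certificateP _ y1) zE]; split=> // w _.
have zx0 : A *m (z - x) = 0 by rewrite mulmxBr Az subrr.
rewrite (gap z) zx0 zE subrr dot0r mulr0 !addr0.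
by rewrite (gap w) lerDl addr_ge0.
Qed.

(** Moving the single coordinate [i] by [t] changes the objective by a quadratic in
    [t] plus the variation of [|x_i + t|]; its one-sided slopes at 0 are
    nonnegative. *)
Lemma solS_kkt lambda b x : 0 < lambda -> solS lambda b A x -> forall i,
  `|coldot A i (b - A *m x)| <= lambda /\
  coldot A i (b - A *m x) * x i 0 = lambda * `|x i 0|.
Proof.
move=> lpos; rewrite solS_gt0 // => -[_ xmin] i.
set g := coldot A i (b - A *m x); set a := x i 0.
pose q := dot (col i A) (col i A).
have q0 : 0 <= q by exact: dot_ge0.
have key t : 0 <= 2^-1 * q * t ^+ 2 - g * t + lambda * (`|a + t| - `|a|).
  have := xmin (x + t *: delta_mx i 0) I; rewrite lasso_objD //.
  rewrite -scalemxAr -colE dotZl !dotZr -/q (dotC _ (col i A)) -coldotE -/g.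
  have -> : norm1 (x + t *: delta_mx i 0) - norm1 x = `|a + t| - `|a|.
    rewrite /norm1 (bigD1 i) //= [X in _ - X](bigD1 i) //= !mxE !eqxx mulr1 -/a.
    have -> : \sum_(j | j != i) `|(x + t *: delta_mx i 0) j 0| =
        \sum_(j | j != i) `|x j 0|.
      by apply: eq_bigr => j ji; rewrite !mxE (negPf ji) mulr0 addr0.
    by rewrite opprD addrACA subrr addr0.
  move: (lasso_obj _ _ _) (`|a + t| - `|a|) => F D.
  rewrite -subr_ge0 -(pmulr_rge0 _ lpos) => h; apply: le_trans h _.
  by rewrite le_eqVlt; apply/orP; left; apply/eqP; field; lra.
have half_q : 0 <= 2^-1 * q by lra.
have [a0|an0] := eqVneq a 0.
  rewrite a0 normr0 !mulr0; split=> //.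
  have {}key t : 0 <= 2^-1 * q * t ^+ 2 - g * t + lambda * `|t|.
    by have := key t; rewrite a0 add0r normr0 subr0.
  rewrite ler_norml; apply/andP; split.
    suff : - g - lambda <= 0 by lra.
    apply: (slope_le0 half_q ltr01) => t t0 _.
    by have := key (- t); rewrite sqrrN normrN gtr0_norm //; lra.
  suff : g - lambda <= 0 by lra.
  apply: (slope_le0 half_q ltr01) => t t0 _.
  by have := key t; rewrite gtr0_norm //; lra.
have a0 : 0 < `|a| by rewrite normr_gt0.
suff -> : g = lambda * Num.sg a.
  by rewrite normrM normr_sg an0 mulr1 gtr0_norm // -mulrA -normrEsg.
have near_a t : `|t| <= `|a| -> `|a + t| - `|a| = Num.sg a * t.
  move: (an0); rewrite neq_lt => /orP[an|ap].
    rewrite (ltr0_norm an) ler_norml ltr0_sg // => /andP[t1 t2].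
    by rewrite ler0_norm; lra.
  rewrite (gtr0_norm ap) ler_norml gtr0_sg // => /andP[t1 t2].
  by rewrite ger0_norm; lra.
apply/eqP; rewrite eq_le -subr_le0 -[X in _ && X]subr_le0; apply/andP; split.
  apply: (slope_le0 half_q a0) => t t0 ta.
  by have := key t; rewrite near_a ?(gtr0_norm t0) //; lra.
apply: (slope_le0 half_q a0) => t t0 ta.
by have := key (- t); rewrite sqrrN near_a ?normrN ?(gtr0_norm t0) //; lra.
Qed.

End Certificates.

(** * Strict certificates from uniqueness *)

Lemma separable_continuous (R : realType) (n : nat) (g : 'I_n -> R -> R) :
  (forall i, continuous (g i)) ->
  continuous (fun v : 'rV[R]_n => \sum_i g i (v 0 i)).
Proof.
move=> gc; apply: (@continuous_big R^o) => [|i _ v].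
  exact: add_continuous.
exact: (continuous_comp (@coord_continuous _ _ _ 0 i v) (gc i _)).
Qed.

(** The constraint [\sum_i k i (d i 0) = c] serves to select the unit l1 sphere in
    one application and is trivial in the other. *)
Lemma kernel_min (R : realType) (m n : nat) (A : 'M[R]_(m, n))
    (g k : 'I_n -> R -> R) (c r : R) :
  (forall i, continuous (g i)) -> (forall i, continuous (k i)) ->
  let D := [set d : 'cV[R]_n | [/\ A *m d = 0, \sum_i k i (d i 0) = c &
    forall i, `|d i 0| <= r]] in
  D !=set0 ->
  exists2 d, D d & forall e, D e -> \sum_i g i (d i 0) <= \sum_i g i (e i 0).
Proof.
move=> gc kc D [d0 Dd0].
pose C := [set v : 'rV[R]_n | D v^T].
have Ccpt : compact C.
  pose box := [set v : 'rV[R]_n | forall i, `[- r, r]%classic (v ord0 i)].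
  have boxc : compact box.
    apply: (@rV_compact R n (fun=> `[- r, r]%classic)) => _.
    exact: segment_compact.
  apply: (subclosed_compact _ boxc).
    pose ev i (v : 'rV[R]_n) := \sum_j A i j * v 0 j.
    pose K := fun v : 'rV[R]_n => \sum_i k i (v 0 i).
    pose sz i := fun v : 'rV[R]_n => `|v 0 i|.
    have -> : C = (\bigcap_(i in [set: 'I_m]) (ev i @^-1` [set x | x = 0]) `&`
        K @^-1` [set x | x = c]) `&`
        \bigcap_(i in [set: 'I_n]) (sz i @^-1` [set x | x <= r]).
      apply/seteqP; split=> v.
        move=> [Av Kv vr]; split; last first.
          by move=> i _; have := vr i; rewrite mxE.
        split; last by rewrite /= -Kv; apply: eq_bigr => i _; rewrite mxE.
        move=> i _; move/matrixP: Av => /(_ i 0); rewrite !mxE /= => <-.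
        by apply: eq_bigr => j _; rewrite mxE.
      move=> [[Av Kv] vr]; split.
      - apply/matrixP => i j; rewrite ord1 !mxE -[RHS](Av i I).
        by apply: eq_bigr => l _; rewrite mxE.
      - by rewrite -Kv; apply: eq_bigr => i _; rewrite mxE.
      - by move=> i; rewrite mxE; exact: vr.
    apply: closedI; [apply: closedI|].
    - apply: closed_bigI => i _; apply: preimage_closed (@closed_eq _ 0) => v _.
      apply: (@separable_continuous R n (fun j x => A i j * x)) => j x.
      exact: (@continuousM _ _ (cst (A i j)) id _ (@cst_continuous _ _ _ _)).
    - apply: preimage_closed (@closed_eq _ c) => v _.
      exact: (@separable_continuous R n k).
    - apply: closed_bigI => i _; apply: preimage_closed (@closed_le _ r) => v _.
      exact: (continuous_comp (@coord_continuous _ _ _ 0 i v)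
        (@norm_continuous _ R^o _)).
  by move=> v [_ _ vr] i /=; rewrite in_itv /= -ler_norml; have := vr i; rewrite mxE.
have C0 : C !=set0 by exists d0^T; rewrite /C /= trmxK.
have /(EVT_min_rV C0 Ccpt) [v] : {within C, continuous
    (fun v : 'rV[R]_n => \sum_i g i (v 0 i))}.
  exact/continuous_subspaceT/(@separable_continuous R n g).
rewrite inE => Cv vmin; exists v^T => // e De.
have := vmin e^T; rewrite inE /C /= trmxK => /(_ De).
have rowE (u : 'rV[R]_n) : \sum_i g i (u^T i 0) = \sum_i g i (u 0 i).
  by apply: eq_bigr => i _; rewrite mxE.
by rewrite -!rowE trmxK.
Qed.

(** Compactness of the unit l1 sphere of [ker A] and homogeneity. *)
Lemma kernel_coercive (R : realType) (m n : nat) (A : 'M[R]_(m, n))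
    (g : 'I_n -> R -> R) :
  (forall i, continuous (g i)) ->
  (forall i (a t : R), 0 <= a -> g i (a * t) = a * g i t) ->
  (forall d : 'cV_n, A *m d = 0 -> d != 0 -> 0 < \sum_i g i (d i 0)) ->
  exists2 e : R, 0 < e &
    forall d, A *m d = 0 -> e * norm1 d <= \sum_i g i (d i 0).
Proof.
move=> gc gZ gpos.
have norm1_gt0 (d : 'cV[R]_n) : d != 0 -> 0 < norm1 d.
  move=> d0; rewrite lt_neqAle eq_sym sumr_ge0 // andbT.
  apply: contra d0 => /eqP/psumr_eq0P d0; apply/eqP/colP => i.
  by rewrite mxE; apply/eqP; rewrite -normr_eq0 d0.
have norm1_0 : norm1 (0 : 'cV[R]_n) = 0.
  by rewrite /norm1 big1 // => i _; rewrite mxE normr0.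
have g0 : \sum_i g i ((0 : 'cV[R]_n) i 0) = 0.
  by rewrite big1 // => i _; rewrite mxE -[X in g i X](mul0r 0) gZ // mul0r.
pose u (d : 'cV[R]_n) := (norm1 d)^-1 *: d.
have gu (d : 'cV[R]_n) : d != 0 -> \sum_i g i (d i 0) = norm1 d * \sum_i g i (u d i 0).
  move=> /norm1_gt0 d0; rewrite mulr_sumr; apply: eq_bigr => i _.
  by rewrite mxE gZ ?invr_ge0 ?ltW // mulVKf ?gt_eqF.
pose D := [set d : 'cV[R]_n | [/\ A *m d = 0, \sum_i `|d i 0| = 1 &
    forall i, `|d i 0| <= 1]].
have Du (d : 'cV[R]_n) : A *m d = 0 -> d != 0 -> D (u d).
  move=> Ad /norm1_gt0 d0.
  have u1 : \sum_i `|u d i 0| = 1.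
    rewrite (eq_bigr (fun i => (norm1 d)^-1 * `|d i 0|)) => [|i _]; last first.
      by rewrite mxE normrM gtr0_norm ?invr_gt0.
    by rewrite -mulr_sumr mulVf // gt_eqF.
  split=> //; first by rewrite -scalemxAr Ad scaler0.
  by move=> i; rewrite -u1 (bigD1 i) //= lerDl sumr_ge0.
have normc (i : 'I_n) : continuous (fun t : R => `|t|).
  exact: (@norm_continuous _ R^o).
have [D0|D0] := pselect (D !=set0); last first.
  exists 1 => // d Ad; have [->|d0] := eqVneq d 0.
    by rewrite g0 norm1_0 mulr0.
  by case: D0; exists (u d); apply: Du.
have [d0 [Ad0 nd0 _] dmin] := kernel_min gc normc D0.
exists (\sum_i g i (d0 i 0)).
  apply: gpos => //; apply: contra_eq_neq nd0 => ->.
  by rewrite big1 ?(eq_sym 0) ?oner_neq0 // => i _; rewrite mxE normr0.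
move=> d Ad; have [->|dn0] := eqVneq d 0.
  by rewrite g0 norm1_0 mulr0.
by rewrite (gu d) // mulrC ler_pM2l ?norm1_gt0 // dmin //; exact: Du.
Qed.

Lemma rowspaceP (R : realType) (m n : nat) (A : 'M[R]_(m, n)) (w : 'cV[R]_n) :
  (forall d, A *m d = 0 -> dot w d = 0) -> exists y, w = A^T *m y.
Proof.
move=> wker; have /submxP[z zE] : (w^T <= A)%MS.
  rewrite submxE; apply/eqP/matrixP => i j; rewrite [RHS]mxE ord1.
  have := wker (col j (cokermx A)).
  rewrite colE mulmxA mulmx_coker mul0mx => /(_ erefl).
  by rewrite /dot mulmxA -colE mxE.
by exists z^T; rewrite -trmx_mul -zE trmxK.
Qed.

(** A one-sided quadratic bound is enough to read off stationarity at a minimizer;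
    it holds because the second derivative of [sqrt (1 + t^2)] is at most 1. *)
Lemma sqrt_taylor (R : realType) (t u : R) :
  Num.sqrt (1 + (t + u) ^+ 2) <=
    Num.sqrt (1 + t ^+ 2) + t / Num.sqrt (1 + t ^+ 2) * u + u ^+ 2.
Proof.
set h := Num.sqrt (1 + t ^+ 2).
have t2 := sqr_ge0 t; have u2 := sqr_ge0 u.
have h2 : h ^+ 2 = 1 + t ^+ 2 by rewrite sqr_sqrtr //; lra.
have h1 : 1 <= h by rewrite -[1]sqrtr1 ler_wsqrtr; lra.
have h0 : h != 0 by lra.
(* The right-hand side is nonnegative, so it suffices to compare squares. *)
have low : 0 <= h + t / h * u + u ^+ 2.
  suff : 0 <= h * (h + t / h * u + u ^+ 2) by rewrite pmulr_rge0 //; lra.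
  have -> : h * (h + t / h * u + u ^+ 2) = 1 + t ^+ 2 + t * u + h * u ^+ 2.
    by rewrite -h2; field.
  have : u ^+ 2 <= h * u ^+ 2 by rewrite ler_peMl.
  have := sqr_ge0 (t + u); nra.
rewrite -(ger0_norm low) -sqrtr_sqr ler_wsqrtr //.
have -> : (h + t / h * u + u ^+ 2) ^+ 2 =
    1 + t ^+ 2 + 2 * t * u + 2 * (h * u ^+ 2) + (t / h * u + u ^+ 2) ^+ 2.
  by rewrite -h2; field.
have : u ^+ 2 <= h * u ^+ 2 by rewrite ler_peMl.
by have := sqr_ge0 (t / h * u + u ^+ 2); nra.
Qed.

(** A step short enough that moving from [x] along [d] reverses no nonzero
    coordinate. *)
Lemma small_step (R : realType) (n : nat) (x d : 'cV[R]_n) :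
  exists2 t : R, 0 < t & forall i, x i 0 != 0 -> `|t * d i 0| <= `|x i 0|.
Proof.
(* Since 0^-1 = 0, zero coordinates of x do not contribute. *)
pose s := 1 + \sum_i `|d i 0| * `|x i 0|^-1.
have s1 : 1 <= s by rewrite lerDl sumr_ge0 // => i _; rewrite mulr_ge0 // invr_ge0.
have s0 : 0 < s by lra.
exists s^-1; first by rewrite invr_gt0.
move=> i xn0; rewrite normrM gtr0_norm ?invr_gt0 // ler_pdivrMl // mulrC.
rewrite -ler_pdivrMl ?normr_gt0 // mulrC /s (bigD1 i) //= addrCA lerDl.
by rewrite addr_ge0 // sumr_ge0 // => j _; rewrite mulr_ge0 // invr_ge0.
Qed.

(** Strict complementarity for a unique minimizer.  With [g] the directional
    derivative of the norm at [x], [f] is a smooth majorant of it which is still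
    coercive on [ker A]; the gradient [w] of [f] at a minimizer over [ker A] is
    orthogonal to [ker A], so it is [A^T y] for some [y]. *)
Lemma strict_certificate (R : realType) (m n : nat) (A : 'M[R]_(m, n))
    (x : 'cV[R]_n) :
  (forall d, A *m d = 0 -> d != 0 -> norm1 x < norm1 (x + d)) ->
  exists y : 'cV[R]_m, forall i,
    (x i 0 = 0 -> `|coldot A i y| < 1) /\
    (x i 0 != 0 -> coldot A i y = Num.sg (x i 0)).
Proof.
move=> xmin.
pose g i (t : R) := if x i 0 == 0 then `|t| else Num.sg (x i 0) * t.
have gc i : continuous (g i).
  rewrite /g; case: eqP => _ t; first exact: (@norm_continuous _ R^o).
  exact: (@continuousM _ _ (cst _) id _ (@cst_continuous _ _ _ _)).
have gZ i (a t : R) : 0 <= a -> g i (a * t) = a * g i t.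
  by move=> a0; rewrite /g; case: eqP => _; [rewrite normrM ger0_norm|rewrite mulrCA].
have gpos (d : 'cV_n) : A *m d = 0 -> d != 0 -> 0 < \sum_i g i (d i 0).
  move=> Ad d0; have [t t0 tsmall] := small_step x d.
  have := xmin (t *: d).
  rewrite -scalemxAr Ad scaler0 scaler_eq0 gt_eqF // => /(_ erefl d0).
  rewrite -subr_gt0 /norm1 -sumrB (eq_bigr (fun i => t * g i (d i 0))).
    by rewrite -mulr_sumr pmulr_rgt0.
  move=> i _; rewrite !mxE /g; case: eqVneq => [->|xn0].
    by rewrite add0r normr0 subr0 normrM gtr0_norm.
  move: (tsmall i xn0); rewrite mulrCA; move: (t * d i 0) => u.
  move: (xn0); rewrite neq_lt => /orP[xn|xp].
    rewrite (ltr0_norm xn) ler_norml ltr0_sg // => /andP[t1 t2].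
    by rewrite ler0_norm; lra.
  rewrite (gtr0_norm xp) ler_norml gtr0_sg // => /andP[t1 t2].
  by rewrite ger0_norm; lra.
have [e e0 gcoer] := kernel_coercive gc gZ gpos.
pose f i (t : R) := if x i 0 == 0 then Num.sqrt (1 + t ^+ 2) else Num.sg (x i 0) * t.
have fc i : continuous (f i).
  rewrite /f; case: eqP => _ t; last first.
    exact: (@continuousM _ _ (cst _) id _ (@cst_continuous _ _ _ _)).
  apply: (@continuous_comp _ _ _ (fun t : R => 1 + t ^+ 2)); last exact: sqrt_continuous.
  apply: (@continuousD _ R^o _ (cst 1)); first exact: cst_continuous.
  exact: exprn_continuous.
have le_gf i t : g i t <= f i t.
  rewrite /g /f; case: eqP => // _; rewrite -sqrtr_sqr ler_wsqrtr //; lra.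
(* Outside the box of radius r the coercivity of g makes the sum of the f i larger
   than n, which bounds that sum at 0. *)
pose r := n%:R / e.
have f0 : \sum_i f i 0 <= n%:R.
  rewrite -[X in _ <= X%:R]card_ord -sumr_const; apply: ler_sum => i _.
  by rewrite /f; case: eqP => _; rewrite ?expr0n ?addr0 ?sqrtr1 ?mulr0.
have D0 : [set d : 'cV[R]_n | [/\ A *m d = 0, \sum_(i < n) (cst 0 (d i 0) : R) = 0 &
    forall i, `|d i 0| <= r]] !=set0.
  exists 0; split; rewrite ?mulmx0 ?big1 // => i.
  by rewrite mxE normr0 divr_ge0 // ltW.
have [d [Ad _ _] dmin0] := kernel_min fc (fun i => @cst_continuous R R 0) D0.
have dmin (z : 'cV[R]_n) : A *m z = 0 -> \sum_i f i (d i 0) <= \sum_i f i (z i 0).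
  move=> Az; have [/forallP zr|] := boolP [forall i, `|z i 0| <= r].
    by apply: dmin0; split=> //; rewrite big1.
  rewrite negb_forall => /existsP[i]; rewrite -ltNge => zi.
  apply: (@le_trans _ _ (\sum_i f i 0)).
    rewrite [leRHS](eq_bigr (fun i => f i ((0 : 'cV[R]_n) i 0))) => [|j _];
      last by rewrite mxE.
    apply: dmin0; split; rewrite ?mulmx0 ?big1 // => j.
    by rewrite mxE normr0 divr_ge0 // ltW.
  apply: le_trans f0 _; apply: (@le_trans _ _ (e * norm1 z)).
    rewrite mulrC -ler_pdivrMr //; apply: le_trans (ltW zi) _.
    by rewrite /norm1 (bigD1 i) //= lerDl sumr_ge0.
  by apply: le_trans (gcoer _ Az) _; apply: ler_sum.
pose w := \col_i (if x i 0 == 0 then d i 0 / Num.sqrt (1 + d i 0 ^+ 2)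
  else Num.sg (x i 0)).
have ftaylor i u : f i (d i 0 + u) <= f i (d i 0) + w i 0 * u + u ^+ 2.
  rewrite mxE /f; case: eqP => _; first exact: sqrt_taylor.
  by rewrite mulrDr lerDl sqr_ge0.
have stat (z : 'cV[R]_n) : A *m z = 0 -> dot w z <= 0.
  move=> Az; have Q0 : 0 <= \sum_i z i 0 ^+ 2 by apply: sumr_ge0 => i _; rewrite sqr_ge0.
  apply: (slope_le0 Q0 ltr01) => t _ _.
  have := dmin (d - t *: z); rewrite mulmxBr -scalemxAr Az Ad scaler0 subr0.
  move=> /(_ erefl); rewrite -subr_ge0 -sumrB => h; apply: le_trans h _.
  rewrite dotE !mulr_suml -sumrB; apply: ler_sum => i _; rewrite lerBlDr !mxE.
  have := ftaylor i (- (t * z i 0)); rewrite sqrrN exprMn !mxE; lra.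
have [|y yE] := @rowspaceP _ _ _ A w.
  move=> z Az; apply/eqP; rewrite eq_le stat //= -oppr_le0 -dotNr stat //.
  by rewrite mulmxN Az oppr0.
exists y => i; rewrite coldot_tr -yE mxE; case: eqVneq => [_|xn0];
  split=> // x0; last by rewrite x0 eqxx in xn0.
have d2 := sqr_ge0 (d i 0).
have h0 : 0 < Num.sqrt (1 + d i 0 ^+ 2) by rewrite sqrtr_gt0; lra.
rewrite normrM normfV (gtr0_norm h0) ltr_pdivrMr // mul1r.
by rewrite -sqrtr_sqr ltr_sqrt; lra.
Qed.

(** * The pieces of the graph attached to index partitions *)

Lemma calI_cases (n : nat) (p : index_triple n) : calI p -> forall i,
  [\/ [/\ (i \in Ipos p) = true, (i \in Izero p) = false & (i \in Ineg p) = false],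
      [/\ (i \in Ipos p) = false, (i \in Izero p) = true & (i \in Ineg p) = false] |
      [/\ (i \in Ipos p) = false, (i \in Izero p) = false & (i \in Ineg p) = true]].
Proof.
move=> [dpz dpn dzn cov] i; have := finset.in_setT i; rewrite -cov !inE.
have [ip _|ip] := boolP (i \in Ipos p).
  by apply: Or31; rewrite (disjointFr dpz ip) (disjointFr dpn ip).
have [iz _|iz /= ->] := boolP (i \in Izero p); last exact: Or33.
by apply: Or32; rewrite (disjointFr dzn iz).
Qed.

Definition dual_point (R : realType) (m n : nat) (A : 'M[R]_(m, n))
    (p : index_triple n) (y : 'cV[R]_m) : Prop :=
  [/\ forall i, i \in Ipos p -> coldot A i y = 1,
      forall i, i \in Izero p -> `|coldot A i y| < 1 &
      forall i, i \in Ineg p -> coldot A i y = -1].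

Definition sign_compatible (R : realType) (n : nat) (p : index_triple n)
    (x : 'cV[R]_n) : Prop :=
  [/\ forall i, i \in Ipos p -> 0 <= x i 0,
      forall i, i \in Izero p -> x i 0 = 0 &
      forall i, i \in Ineg p -> x i 0 <= 0].

Definition strict_point (R : realType) (m n : nat) (A : 'M[R]_(m, n))
    (p : index_triple n) (lambda : R) (b : 'cV[R]_m) (x : 'cV[R]_n) : Prop :=
  [/\ forall i, i \in Ipos p ->
        0 < x i 0 /\ coldot A i (b - A *m x) = lambda,
      forall i, i \in Izero p ->
        x i 0 = 0 /\ `|coldot A i (b - A *m x)| < lambda &
      forall i, i \in Ineg p ->
        x i 0 < 0 /\ coldot A i (b - A *m x) = - lambda].

Section Pieces.
Context (R : realType) (m n : nat) (A : 'M[R]_(m, n)).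
Implicit Types (p q : index_triple n) (x d : 'cV[R]_n) (b y : 'cV[R]_m).
Implicit Type lambda : R.

(** Strictness of [y] on the zero block is what forces the entries there to vanish. *)
Lemma dual_point_certificate p x y : calI p -> dual_point A p y ->
  certificate A x y <-> sign_compatible p x.
Proof.
move=> pI [yp yz yn]; split=> [cxy|[xp xz xn] i].
  split=> i ip; have [_] := cxy i.
  - by rewrite yp // mul1r => ->.
  - have [//|xn0 cx] := eqVneq (x i 0) 0.
    have /mulIf cc : `|x i 0| != 0 by rewrite normr_eq0.
    have /cc c1 : `|coldot A i y| * `|x i 0| = 1 * `|x i 0|.
      by rewrite -normrM cx normr_id mul1r.
    by have := yz i ip; rewrite c1 ltxx.
  - by rewrite yn // mulN1r => /eqP; rewrite eqr_oppLR => /eqP ->; rewrite oppr_le0.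
case: (calI_cases pI i) => -[].
- by move=> ip _ _; rewrite yp // normr1 mul1r ger0_norm // xp.
- by move=> _ iz _; rewrite ltW ?yz // xz // mulr0 normr0.
- by move=> _ _ iN; rewrite yn // normrN normr1 mulN1r ler0_norm // xn.
Qed.

Lemma system_certificate p lambda b x : calI p -> 0 < lambda ->
  optimality_system A p lambda b x -> certificate A x (lambda^-1 *: (b - A *m x)).
Proof.
move=> pI lpos [sp sz sn] i; rewrite coldotZ normrM gtr0_norm ?invr_gt0 //.
rewrite ler_pdivrMl // mulr1.
case: (calI_cases pI i) => -[].
- move=> /sp[x0 ->] _ _; rewrite mulVf ?gt_eqF // mul1r.
  by rewrite (ger0_norm x0) gtr0_norm.
- by move=> _ /sz[-> r1] _; rewrite mulr0 normr0.
- move=> _ _ /sn[x0 ->]; rewrite normrN gtr0_norm // mulrN mulVf ?gt_eqF //.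
  by rewrite mulN1r ler0_norm.
Qed.

(** For positive [lambda] the scaled residual of [x0] is a multiplier; since [y]
    also certifies [x0], the two can be exchanged by [certificate_transfer]. *)
Lemma solS_system_point p y lambda b x0 : calI p -> dual_point A p y ->
  0 <= lambda -> optimality_system A p lambda b x0 ->
  solS lambda b A = [set x | A *m x = A *m x0 /\ certificate A x y].
Proof.
move=> pI py l0 s0.
have cx0 : certificate A x0 y.
  by apply/(dual_point_certificate _ pI py); case: s0 => sp sz sn;
    split=> i => [/sp[]|/sz[]|/sn[]].
move: l0; rewrite le_eqVlt => /predU1P[l0|lpos].
  apply: solS_certificate => // [|i]; first by rewrite -l0.
  rewrite -l0 mul0r; case: s0; rewrite -l0 => sp sz sn.
  case: (calI_cases pI i) => -[].
  - by move=> /sp[].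
  - by move=> _ /sz[_]; rewrite normr_le0 => /eqP.
  - by move=> _ _ /sn[_ ->]; rewrite oppr0.
have cr := system_certificate pI lpos s0.
rewrite (solS_certificate (ltW lpos) cr) => [|i]; last first.
  by rewrite coldotZ mulVKf // gt_eqF.
apply/seteqP; split=> x [Ax cx]; split=> //.
  exact: (certificate_transfer (esym Ax) cr cx cx0).
exact: (certificate_transfer (esym Ax) cx0 cx cr).
Qed.

(** Every solution has the image [A *m x] of the given point of the piece, hence the
    same residual; the sign conditions are those certified by the strict [y]. *)
Lemma solS_piece p lambda b : 0 <= lambda -> calK lambda b A p ->
  solS lambda b A = optimality_system A p lambda b.
Proof.
move=> l0 [[pI [y py]] [[[l' b'] x0] [/= _ s0] [El Eb]]].
rewrite {}El {}Eb in s0.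
apply/seteqP; split=> x.
  rewrite (solS_system_point pI py l0 s0) => -[Ax].
  move=> /(dual_point_certificate _ pI py)[xp xz xn].
  case: s0 => sp sz sn; split=> i ip; rewrite Ax.
  - by split; [exact: xp|case: (sp i ip)].
  - by split; [exact: xz|case: (sz i ip)].
  - by split; [exact: xn|case: (sn i ip)].
move=> sx; rewrite (solS_system_point pI py l0 sx); split=> //.
by apply/(dual_point_certificate _ pI py); case: sx => sp sz sn;
  split=> i => [/sp[]|/sz[]|/sn[]].
Qed.

(** Inclusion of the coordinates in [K], so that [cols A K] is a matrix product. *)
Definition embed (K : {set 'I_n}) : 'M[R]_(n, #|K|) :=
  \matrix_(i, k) (i == enum_val k)%:R.

Lemma cols_embed (K : {set 'I_n}) : cols A K = A *m embed K.
Proof.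
apply/matrixP => i k; rewrite !mxE (bigD1 (enum_val k)) //= mxE eqxx mulr1.
by rewrite big1 ?addr0 // => j /negPf jk; rewrite mxE jk mulr0.
Qed.

Lemma embedE (K : {set 'I_n}) (z : 'cV[R]_#|K|) k : (embed K *m z) (enum_val k) 0 = z k 0.
Proof.
rewrite mxE (bigD1 k) //= mxE eqxx mul1r big1 ?addr0 // => l /negPf lk.
by rewrite mxE (inj_eq enum_val_inj) eq_sym lk mul0r.
Qed.

Lemma embed_support (K : {set 'I_n}) r (P : 'M[R]_(#|K|, r)) i j : i \notin K ->
  (embed K *m P) i j = 0.
Proof.
move=> iK; rewrite mxE big1 // => k _; rewrite mxE.
by case: eqP iK => [->|_ _]; rewrite ?enum_valP ?mul0r.
Qed.

(** Vectors supported on [K] replace vectors indexed by ['I_#|K|], so that no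
    reindexing is needed afterwards. *)
Lemma cols_full_rankP (K : {set 'I_n}) : \rank (cols A K) = #|K| <->
  forall d, (forall i, i \notin K -> d i 0 = 0) -> A *m d = 0 -> d = 0.
Proof.
split=> [rK d dK Ad|inj].
  have free : row_free (cols A K)^T by rewrite /row_free mxrank_tr rK.
  pose z : 'cV_#|K| := \col_k d (enum_val k) 0.
  have dE : d = embed K *m z.
    apply/colP => i; have [iK|iK] := boolP (i \in K); last first.
      by rewrite dK // embed_support.
    by rewrite -(enum_rankK_in iK iK) embedE mxE.
  suff -> : d = embed K *m 0 by rewrite mulmx0.
  rewrite {1}dE; congr (_ *m _); apply: trmx_inj; apply: (row_free_inj free).
  by rewrite -!trmx_mul cols_embed -mulmxA -dE Ad mulmx0.
apply/eqP; rewrite -mxrank_tr; apply: inj_row_free => v vA.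
apply/rowP => k; rewrite mxE.
suff d0 : embed K *m v^T = 0 by have := embedE v^T k; rewrite d0 !mxE.
apply: inj => [i|]; first exact: embed_support.
by rewrite mulmxA -cols_embed -[cols A K]trmxK -trmx_mul vA trmx0.
Qed.

End Pieces.

(** * Pieces with independent active columns *)

Section Linearity.
Context (R : realType) (m n : nat) (A : 'M[R]_(m, n)) (p : index_triple n).
Context (pI : calI p).

(** Rows of [A^T A] on the active indices and rows of the identity on the others:
    a square matrix of size [n] encoding the whole linear system without
    extracting the active block. *)
Definition system_matrix : 'M[R]_n :=
  \matrix_(i, j) if i \in Izero p then (i == j)%:R else (A^T *m A) i j.

Definition system_rhs : 'M[R]_(n, 1 + m) :=
  row_mx (\col_i ((i \in Ineg p)%:R - (i \in Ipos p)%:R))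
         (\matrix_(i, k) if i \in Izero p then 0 else A^T i k).

Lemma system_matrixE (x : 'cV[R]_n) i : (system_matrix *m x) i 0 =
  if i \in Izero p then x i 0 else coldot A i (A *m x).
Proof.
rewrite coldot_tr mulmxA !mxE; case: ifPn => iz.
  rewrite (bigD1 i) //= !mxE iz eqxx mul1r big1 ?addr0 // => j ji.
  by rewrite !mxE iz eq_sym (negPf ji) mul0r.
by apply: eq_bigr => j _; rewrite mxE (negPf iz).
Qed.

Lemma system_rhsE (lambda : R) (b : 'cV[R]_m) i :
  (system_rhs *m col_mx lambda%:M b) i 0 =
  ((i \in Ineg p)%:R - (i \in Ipos p)%:R) * lambda +
  if i \in Izero p then 0 else coldot A i b.
Proof.
rewrite mul_row_col mxE; congr (_ + _).
  by rewrite mul_mx_scalar !mxE mulrC.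
rewrite mxE; case: ifPn => iz.
  by rewrite big1 // => j _; rewrite mxE iz mul0r.
by rewrite coldot_tr mxE; apply: eq_bigr => j _; rewrite mxE (negPf iz).
Qed.

Lemma linear_systemE (lambda : R) (b : 'cV[R]_m) (x : 'cV[R]_n) :
  linear_system A p lambda b x <->
  system_matrix *m x = system_rhs *m col_mx lambda%:M b.
Proof.
split=> [[sp sz sn]|/colP E].
  apply/colP => i; rewrite system_matrixE system_rhsE.
  case: (calI_cases pI i) => -[ip iz iN]; rewrite ip iz iN.
  - by rewrite sp // sub0r mulN1r addrC.
  - by rewrite sz // subrr mul0r addr0.
  - by rewrite sn // subr0 mul1r addrC.
split=> i; case: (calI_cases pI i) => -[ip iz iN]; rewrite ?ip ?iz ?iN // => _;
  have := E i; rewrite system_matrixE system_rhsE ip iz iN.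
- by rewrite sub0r mulN1r addrC.
- by rewrite subrr mul0r addr0.
- by rewrite subr0 mul1r addrC.
Qed.

(** A kernel vector [d] is supported on the active set and [A^T A d] vanishes there, so
    [|A d|^2 = 0]. *)
Lemma system_matrix_unit :
  \rank (cols A (Ipos p :|: Ineg p)%SET) = #|(Ipos p :|: Ineg p)%SET| ->
  system_matrix \in unitmx.
Proof.
move=> /cols_full_rankP inj.
rewrite -unitmx_tr -row_free_unit; apply: inj_row_free => v vM.
apply: trmx_inj; rewrite trmx0.
have {}vM : system_matrix *m v^T = 0.
  by rewrite -[LHS]trmxK trmx_mul trmxK vM trmx0.
have vz i : i \in Izero p -> v^T i 0 = 0.
  by move=> iz; have := system_matrixE v^T i; rewrite vM iz mxE.
apply: inj => [i|]; first by case: (calI_cases pI i) => -[ip iz iN];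
  rewrite finset.inE ip iN // => _; apply: vz.
apply: dot_eq0; rewrite dot_range big1 // => i _.
have [iz|iz] := boolP (i \in Izero p); first by rewrite vz // mulr0.
by have := system_matrixE v^T i; rewrite vM (negPf iz) mxE => <-; rewrite mul0r.
Qed.

End Linearity.

Lemma system_linear (R : realType) (m n : nat) (A : 'M[R]_(m, n))
    (p : index_triple n) (lambda : R) (b : 'cV[R]_m) (x : 'cV[R]_n) :
  optimality_system A p lambda b x -> linear_system A p lambda b x.
Proof.
move=> [sp sz sn]; split=> i => [/sp[_]|/sz[]//|/sn[_]];
  rewrite coldotB; lra.
Qed.

Lemma full_rank_piece (R : realType) (m n : nat) (A : 'M[R]_(m, n))
    (p : index_triple n) : calJ0 A p ->
  [/\ single_valued_on (solS_slice A) (P12 (bbG A p)),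
      linear_on (solS_slice A) (P12 (bbG A p)) &
      forall (lambda : R) (b : 'cV[R]_m),
        P12 (bbG A p) (lambda, b) ->
        exists x : 'cV[R]_n,
          solS lambda b A = [set x] /\
          unique (linear_system A p lambda b) x].
Proof.
move=> [pJ full]; have [pI _] := pJ.
have Munit : system_matrix A p \in unitmx.
  apply: system_matrix_unit => //; case: full => // K0.
  by rewrite K0; have := rank_leq_col (cols A finset.set0);
    rewrite [X in (_ <= X)%N -> _]cards0 [in RHS]cards0 leqn0 => /eqP.
pose B := invmx (system_matrix A p) *m system_rhs A p.
pose sol (lambda : R) b := B *m col_mx lambda%:M b.
have solE lambda b x : linear_system A p lambda b x <-> x = sol lambda b.
  rewrite linear_systemE // /sol /B -mulmxA; split=> [<-|->]; first by rewrite mulKmx.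
  by rewrite mulKVmx.
have main lambda b : P12 (bbG A p) (lambda, b) ->
    solS lambda b A = [set sol lambda b].
  move=> Gp; have [[[l' b'] x0] [/= l0 s0] [El Eb]] := Gp.
  rewrite {}El {}Eb in l0 s0.
  rewrite (@solS_piece _ _ _ A p) //; apply/seteqP; split=> x.
    by move=> /system_linear/solE.
  by move=> ->; have /system_linear/solE <- := s0.
split.
- by move=> [lambda b] /main E; exists (sol lambda b).
- by exists B => -[lambda b] /main.
- move=> lambda b /main E; exists (sol lambda b); split=> //.
  by split=> [|x /solE//]; apply/solE.
Qed.

(** A kernel vector supported on the active set changes neither the residual nor, for
    a small step, the signs of the nonzero active entries. *)
Lemma system_move (R : realType) (m n : nat) (A : 'M[R]_(m, n))
    (p : index_triple n) (lambda : R) (b : 'cV[R]_m) (x : 'cV[R]_n) :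
  calI p -> optimality_system A p lambda b x ->
  (forall i, i \notin Izero p -> x i 0 != 0) ->
  \rank (cols A (Ipos p :|: Ineg p)%SET) <> #|(Ipos p :|: Ineg p)%SET| ->
  exists2 x', x' <> x & optimality_system A p lambda b x'.
Proof.
move=> pI [sp sz sn] xn0 /cols_full_rankP /existsNP[d /not_implyP[dz]].
move=> /not_implyP[Ad dn0]; have [t t0 tsmall] := small_step x d.
have Axt : A *m (x + t *: d) = A *m x by rewrite mulmxDr -scalemxAr Ad scaler0 addr0.
exists (x + t *: d).
  move=> /eqP; rewrite -subr_eq0 addrAC subrr add0r scaler_eq0 gt_eqF //=.
  by move=> /eqP.
have small i : i \notin Izero p -> `|t * d i 0| <= `|x i 0|.
  by move=> /xn0 /tsmall.
split=> i ii; rewrite Axt !mxE; case: (calI_cases pI i) => -[ip iz iN];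
  rewrite ?ip ?iz ?iN // in ii.
- have [x0 ->] := sp i ip; split=> //.
  have := small i; rewrite iz (ger0_norm x0) ler_norml => /(_ isT)/andP[h _]; lra.
- have [x0 r1] := sz i iz; split=> //.
  by rewrite x0 dz ?mulr0 ?addr0 // finset.inE ip iN.
- have [x0 ->] := sn i iN; split=> //.
  have := small i; rewrite iz (ler0_norm x0) ler_norml => /(_ isT)/andP[_ h]; lra.
Qed.

(** * Interior points of the pieces *)

(** A least squares solution for the columns in [K] that depends linearly on the
    right-hand side, assembled from the solutions for the unit vectors.  Linearity
    makes the perturbed solutions of [strict_point_interior] continuous. *)
Lemma normal_equation_linear (R : realType) (m n : nat) (A : 'M[R]_(m, n))
    (K : {set 'I_n}) : exists P : 'M[R]_(n, m),
  (forall i (u : 'cV_m), i \notin K -> (P *m u) i 0 = 0) /\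
  (forall i u, i \in K -> coldot A i (u - A *m (P *m u)) = 0).
Proof.
have /fin_all_exists[f fE] : forall k : 'I_m, exists z : 'cV[R]_#|K|,
    (cols A K)^T *m (delta_mx k 0 - cols A K *m z) = 0.
  by move=> k; exact: normal_equation.
pose Q : 'M[R]_(#|K|, m) := \matrix_(i, k) f k i 0.
have QE : (cols A K)^T *m (1%:M - cols A K *m Q) = 0.
  apply/matrixP => i k; rewrite [RHS]mxE.
  have : col k ((cols A K)^T *m (1%:M - cols A K *m Q)) = 0.
    rewrite colE -mulmxA mulmxBl mul1mx -mulmxA -colE.
    by have -> : col k Q = f k by apply/colP => l; rewrite !mxE.
  by move=> /colP/(_ i); rewrite !mxE.
exists (embed R K *m Q); split=> [i u iK|i u iK].
  by rewrite -mulmxA embed_support.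
have /matrixP/(_ (enum_rank_in iK i) 0) : (cols A K)^T *m (u - cols A K *m (Q *m u)) = 0.
  by rewrite mulmxA -{1}[u]mul1mx -mulmxBl mulmxA QE mul0mx.
have -> w k : ((cols A K)^T *m w) k 0 = coldot A (enum_val k) w.
  by rewrite coldot_tr !mxE; apply: eq_bigr => j _; rewrite !mxE.
by rewrite enum_rankK_in // cols_embed -!mulmxA mxE.
Qed.

Lemma near_affine (R : realType) (m : nat) (a c : R) (g : 'cV[R]_m)
    (z0 : R * 'cV[R]_m) :
  0 < a + c * z0.1 + dot g z0.2 ->
  \forall z \near z0, 0 < a + c * z.1 + dot g z.2.
Proof.
move=> F0; have Fc : (fun z : R * 'cV[R]_m => a + c * z.1 + dot g z.2) @ z0 -->
    a + c * z0.1 + dot g z0.2.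
  apply: (@cvgD _ R^o); first apply: (@cvgD _ R^o).
  - exact: cvg_cst.
  - by apply: (@cvgM R); [exact: cvg_cst|exact: cvg_fst].
  - have -> : (fun z : R * 'cV[R]_m => dot g z.2) =
        (fun z => \sum_i g i 0 * z.2 i 0) by apply/funext => z; rewrite dotE.
    rewrite dotE; apply: (@cvg_big R^o); first exact: add_continuous.
    move=> i _; apply: (@cvgM R); first exact: cvg_cst.
    apply: (@cvg_comp _ _ _ snd (fun M : 'cV[R]_m => M i 0) _ (nbhs z0.2)).
      exact: cvg_snd.
    exact: coord_continuous.
exact: (cvgr_gt _ Fc).
Qed.

Lemma near_forall_in (T : topologicalType) (I : finType) (D : {set I})
    (F : I -> T -> Prop) (z0 : T) :
  (forall i, i \in D -> \forall z \near z0, F i z) ->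
  \forall z \near z0, forall i, i \in D -> F i z.
Proof.
move=> h; have := @filter_forall T I (fun i z => i \in D -> F i z) (nbhs z0) _.
apply=> i; have [iD|iD] := boolP (i \in D); last exact: nearW.
by apply: filterS (h i iD) => z.
Qed.

Section Interior.
Context (R : realType) (m n : nat) (A : 'M[R]_(m, n)) (p : index_triple n).
Context (pI : calI p).

Lemma strict_point_system lambda b x : strict_point A p lambda b x ->
  optimality_system A p lambda b x.
Proof.
move=> [sp sz sn]; split=> i.
- by move=> /sp[/ltW].
- by move=> /sz[? /ltW].
- by move=> /sn[/ltW].
Qed.

(** Near [(lambda, b)] keep the scaled residual [y] fixed and absorb the remaining perturbation
    [u] of the data into the active columns by least squares: [x' = x + P u].  The
    residual becomes [lambda' y + v] with [v] orthogonal to the active columns, so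
    the equations hold exactly; the strict inequalities are affine in the data and
    persist. *)
Lemma strict_point_interior lambda b x : 0 < lambda ->
  strict_point A p lambda b x -> interior (P12 (bbG A p)) (lambda, b).
Proof.
move=> lpos [sp sz sn].
have [P [Psupp Pn]] := normal_equation_linear A (Ipos p :|: Ineg p)%SET.
pose y := lambda^-1 *: (b - A *m x).
pose u (z : R * 'cV[R]_m) := (z.2 - b) - (z.1 - lambda) *: y.
have u0 : u (lambda, b) = 0 by rewrite /u /= !subrr scale0r subr0.
have uE g z : dot g (u z) =
    (lambda * dot g y - dot g b) + (- dot g y) * z.1 + dot g z.2.
  by rewrite /u !dotBr dotZr; ring.
have near_u (a c : R) (g : 'cV[R]_m) : 0 < a + c * lambda ->
    \forall z \near (lambda, b), 0 < a + c * z.1 + dot g (u z).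
  move=> h; have := @near_affine _ _ (a + (lambda * dot g y - dot g b))
    (c - dot g y) g (lambda, b).
  have E z : a + (lambda * dot g y - dot g b) + (c - dot g y) * z.1 + dot g z.2
      = a + c * z.1 + dot g (u z) by rewrite uE; ring.
  rewrite E u0 dot0r addr0 => /(_ h); apply: filterS => z.
  by rewrite E.
pose x' z := x + P *m u z.
have x'E z i : x' z i 0 = x i 0 + dot (row i P)^T (u z).
  by rewrite mxE /dot trmxK -row_mul [in RHS]mxE.
pose v z := u z - A *m (P *m u z).
have Ax : A *m x = b - lambda *: y.
  by rewrite /y scalerA mulfV ?gt_eqF // scale1r opprB addrC subrK.
have vE z : z.2 - A *m x' z = z.1 *: y + v z.
  rewrite /v /x' mulmxDr Ax opprD addrA [in RHS]addrA; congr (_ - _).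
  by apply/colP => i; rewrite /u !mxE; ring.
have vdot z i : coldot A i (v z) = dot ((1%:M - A *m P)^T *m col i A) (u z).
  rewrite /dot trmx_mul trmxK -mulmxA mulmxBl mul1mx -[A *m P *m _]mulmxA.
  by rewrite coldotE /dot.
have yE i : coldot A i y = lambda^-1 * coldot A i (b - A *m x).
  by rewrite coldotZ.
have yp i : i \in Ipos p -> coldot A i y = 1.
  by move=> /sp[_]; rewrite yE => ->; rewrite mulVf ?gt_eqF.
have yn i : i \in Ineg p -> coldot A i y = -1.
  by move=> /sn[_]; rewrite yE => ->; rewrite mulrN mulVf ?gt_eqF.
have lnear : \forall z \near (lambda, b), 0 < z.1.
  have := near_u 0 1 0; rewrite add0r mul1r => /(_ lpos).
  by apply: filterS => z; rewrite add0r mul1r dotC dot0r addr0.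
have xpnear : \forall z \near (lambda, b), forall i, i \in Ipos p -> 0 < x' z i 0.
  apply: near_forall_in => i ip.
  have := near_u (x i 0) 0 (row i P)^T; rewrite mul0r addr0.
  move=> /(_ (sp i ip).1); apply: filterS => z.
  by rewrite x'E mul0r addr0.
have xnnear : \forall z \near (lambda, b), forall i, i \in Ineg p -> x' z i 0 < 0.
  apply: near_forall_in => i iN.
  have := near_u (- x i 0) 0 (- (row i P)^T); rewrite mul0r addr0 oppr_gt0.
  move=> /(_ (sn i iN).1); apply: filterS => z.
  by rewrite x'E mul0r addr0 dotC dotNr dotC; lra.
have rnear (s : R) : `|s| = 1 -> \forall z \near (lambda, b),
    forall i, i \in Izero p -> 0 < z.1 + s * coldot A i (z.2 - A *m x' z).
  move=> s1; apply: near_forall_in => i iz.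
  have := near_u 0 (1 + s * coldot A i y) (s *: ((1%:M - A *m P)^T *m col i A)).
  rewrite add0r mulrDl mul1r -mulrA yE mulrAC mulVf ?gt_eqF // mul1r.
  have [_ ri] := sz i iz.
  have sr : `|s * coldot A i (b - A *m x)| < lambda by rewrite normrM s1 mul1r.
  have /= lo : 0 < lambda + s * coldot A i (b - A *m x).
    by move: sr; rewrite ltr_norml => /andP[]; lra.
  move=> /(_ lo); apply: filterS => z.
  rewrite vE [coldot A i (_ *: _ + _)]coldotD coldotZ vdot.
  by rewrite (dotC (s *: _)) dotZr dotC yE; lra.
have r1 := rnear 1 (normr1 _).
have r2 := rnear (-1) (normrN1 _).
rewrite /interior /=; near=> z.
have l0 : 0 < z.1 by near: z.
have xp : forall i, i \in Ipos p -> 0 < x' z i 0 by near: z.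
have xn : forall i, i \in Ineg p -> x' z i 0 < 0 by near: z.
have lo : forall i, i \in Izero p -> 0 < z.1 + 1 * coldot A i (z.2 - A *m x' z).
  by near: z.
have hi : forall i, i \in Izero p -> 0 < z.1 + -1 * coldot A i (z.2 - A *m x' z).
  by near: z.
exists (z, x' z) => //; split; first exact: ltW.
split=> i ii /=.
- split; first by apply/ltW/xp.
  by rewrite vE coldotD coldotZ yp // mulr1 Pn ?addr0 // finset.inE ii.
- have /= xi0 : x i 0 = 0 by case: (sz i ii).
  split; first by rewrite mxE xi0 Psupp ?addr0 //;
    case: (calI_cases pI i) ii => -[ip iz iN]; rewrite iz // finset.inE ip iN.
  rewrite ler_norml; have /= := lo i ii; have /= := hi i ii.
  by move=> ? ?; apply/andP; split; lra.
- split; first by apply/ltW/xn.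
  by rewrite vE coldotD coldotZ yn // mulrN1 Pn ?addr0 // finset.inE ii orbT.
Unshelve. all: by end_near. Qed.

End Interior.

(** * Dependent active columns, uniqueness and segments *)

Lemma sign_partition_calI (R : realType) (n : nat) (x : 'cV[R]_n) :
  calI (sign_partition x).
Proof.
split.
- apply/pred0P => i; rewrite inE /= !finset.inE.
  by case: ltgtP.
- apply/pred0P => i; rewrite inE /= !finset.inE.
  by case: ltgtP.
- apply/pred0P => i; rewrite inE /= !finset.inE.
  by case: ltgtP.
- apply/finset.setP => i; rewrite !finset.inE.
  by case: ltgtP.
Qed.

Section Main.
Context (R : realType) (m n : nat) (A : 'M[R]_(m, n)).

(** Take the signs of the partition as entries, the dual point as residual and
    [lambda = 1]. *)
Lemma strict_point_exists p : calJ A p ->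
  exists b x, strict_point A p 1 b x.
Proof.
move=> [pI [y [yp yz yn]]].
pose x : 'cV[R]_n := \col_i ((i \in Ipos p)%:R - (i \in Ineg p)%:R).
exists (A *m x + y), x.
have -> : strict_point A p 1 (A *m x + y) x =
    [/\ forall i, i \in Ipos p -> 0 < x i 0 /\ coldot A i y = 1,
        forall i, i \in Izero p -> x i 0 = 0 /\ `|coldot A i y| < 1 &
        forall i, i \in Ineg p -> x i 0 < 0 /\ coldot A i y = - 1].
  by rewrite /strict_point [A *m x + y]addrC addrK.
split=> i ii; rewrite mxE; case: (calI_cases pI i) => -[ip iz iN];
  rewrite ?ip ?iz ?iN // in ii *.
- by rewrite subr0 ltr01 yp.
- by rewrite subrr yz.
- by rewrite sub0r oppr_lt0 ltr01 yn.
Qed.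

(** The piece is a convex cone: subtracting a small multiple of a strict point from
    an interior point leaves a point of the piece, and adding the multiple back
    makes all its inequalities strict. *)
Lemma interior_strict_point p (lambda : R) (b : 'cV[R]_m) : calJ A p ->
  interior (P12 (bbG A p)) (lambda, b) ->
  0 < lambda /\ exists x, strict_point A p lambda b x.
Proof.
move=> pJ; have [b1 [x1 [sp1 sz1 sn1]]] := strict_point_exists pJ => zint.
have cvgl : (fun t : R => lambda - t) @ (0 : R) --> lambda.
  rewrite -[X in _ --> X]subr0.
  by apply: (@cvgB _ R^o); [exact: cvg_cst|exact: cvg_id].
have cvgb : (fun t : R => b - t *: b1) @ (0 : R) --> b.
  rewrite -[X in _ --> X]subr0 -[X in _ - X](scale0r b1).
  by apply: cvgB; [exact: cvg_cst|apply: cvgZr_tmp; exact: cvg_id].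
have cvg0 := cvg_pair cvgl cvgb.
have [/= t t0 Gt] : exists2 t : R, 0 < t & P12 (bbG A p) (lambda - t, b - t *: b1).
  have near0 : \forall t \near (0 : R), P12 (bbG A p) (lambda - t, b - t *: b1).
    exact: cvg0 _ _ _ _ zint.
  have /nbhs_ballP[e /= e0 he] := near0.
  exists (e / 2); first by rewrite divr_gt0.
  apply: he; rewrite /ball /= sub0r normrN gtr0_norm ?divr_gt0 //.
  by rewrite ltr_pdivrMr //; lra.
have [[[l2 b2] x2] [/= l20 [sp2 sz2 sn2]] [El Eb]] := Gt.
have lE : lambda = l2 + t by rewrite El subrK.
have bE : b = b2 + t *: b1 by rewrite Eb subrK.
split; first by rewrite lE; lra.
exists (x2 + t *: x1).
have rE i : coldot A i (b - A *m (x2 + t *: x1)) =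
    coldot A i (b2 - A *m x2) + t * coldot A i (b1 - A *m x1).
  rewrite -coldotZ -coldotD; congr coldot.
  by rewrite bE mulmxDr scalerBr -scalemxAr opprD addrACA.
split=> i ii; rewrite rE !mxE lE.
- have [x1i ->] := sp1 i ii; have [x2i ->] := sp2 i ii.
  by rewrite mulr1 ltr_wpDl // mulr_gt0.
- have [-> r1] := sz1 i ii; have [-> r2] := sz2 i ii.
  rewrite mulr0 addr0; split=> //; apply: le_lt_trans (ler_normD _ _) _.
  by rewrite ler_ltD // normrM gtr0_norm // gtr_pMr.
- have [x1i ->] := sn1 i ii; have [x2i ->] := sn2 i ii.
  split; last by rewrite mulrN1 opprD.
  by rewrite ltr_wnDl // pmulr_rlt0.
Qed.

Lemma deficient_piece p : (calJ A `\` calJ0 A) p ->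
  interior (P12 (bbG A p)) !=set0 /\
  forall z : R * 'cV[R]_m, interior (P12 (bbG A p)) z ->
    ~ single_valued_at (solS_slice A) z.
Proof.
move=> [pJ pJ0]; have [pI _] := pJ; split.
  have [b [x sx]] := strict_point_exists pJ.
  by exists (1, b); apply: strict_point_interior sx.
move=> [lambda b] zint [x0 Sx0].
have [lpos [x sx]] := interior_strict_point pJ zint.
have [||x' x'x sx'] := @system_move _ _ _ A p lambda b x pI (strict_point_system sx).
- move=> i iz; case: sx => sp _ sn.
  case: (calI_cases pI i) => -[ip iz' iN]; last 1 first.
  + by have [/lt_eqF -> _] := sn i iN.
  + by have [/gt_eqF -> _] := sp i ip.
  + by rewrite iz' in iz.
- by move=> full; apply: pJ0; split=> //; right.
have SE : solS lambda b A = optimality_system A p lambda b.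
  apply: solS_piece (ltW lpos) _; split=> //.
  exact: interior_subset zint.
have E z : optimality_system A p lambda b z -> z = x0.
  by rewrite -SE -[solS _ _ _]/(solS_slice A (lambda, b)) Sx0.
by apply: x'x; rewrite (E _ sx') (E _ (strict_point_system sx)).
Qed.

(** Uniqueness gives the strict dual point through [strict_certificate], and it
    excludes dependent active columns because [system_move] would produce a second
    solution. *)
Lemma unique_sign_partition (lambda : R) (b : 'cV[R]_m) (x : 'cV[R]_n) :
  solS lambda b A = [set x] ->
  (calK lambda b A `&` calJ0 A) (sign_partition x).
Proof.
move=> Sx; have xS : solS lambda b A x by rewrite Sx.
have l0 := solS_ge0 xS.
have uniq z : solS lambda b A z -> z = x by rewrite Sx.
have xmin d : A *m d = 0 -> d != 0 -> norm1 x < norm1 (x + d).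
  move=> Ad dn0; rewrite ltNge; apply/negP => le_xd.
  have Axd : A *m (x + d) = A *m x by rewrite mulmxDr Ad addr0.
  have /uniq/eqP : solS lambda b A (x + d).
    move: xS l0; rewrite le_eqVlt => xS /predU1P[l0|lpos].
      move: xS; rewrite -l0 solS_0 => -[Ax xm]; split; first by rewrite /= Axd.
      by move=> z /xm; exact: le_trans.
    move: xS; rewrite solS_gt0 // => -[_ xm]; split=> // z /xm.
    by apply: le_trans; rewrite /lasso_obj Axd lerD2l.
  by rewrite -subr_eq0 addrAC subrr add0r (negPf dn0).
have [y yE] := strict_certificate xmin.
have pI := sign_partition_calI x.
have pJ : calJ A (sign_partition x).
  split=> //; exists y; split=> i; rewrite finset.inE => xi; have [y0 y1] := yE i.
  - by rewrite y1 ?gtr0_sg ?gt_eqF.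
  - by apply: y0; apply/eqP.
  - by rewrite y1 ?ltr0_sg ?lt_eqF.
have sx : optimality_system A (sign_partition x) lambda b x.
  move: xS l0; rewrite le_eqVlt => xS /predU1P[l0|lpos].
    move: xS; rewrite -l0 solS_0 => -[/eq_projP Ax _].
    split=> i; rewrite finset.inE => xi; rewrite Ax ?oppr0 ?normr0.
    - by rewrite ltW.
    - by move/eqP: xi.
    - by rewrite ltW.
  have kkt := solS_kkt lpos xS.
  split=> i; rewrite finset.inE => xi; have [r1 r2] := kkt i.
  - split; first exact: ltW.
    apply: (@mulIf _ (x i 0)); first by rewrite gt_eqF.
    by rewrite r2 gtr0_norm.
  - by move/eqP: xi.
  - split; first exact: ltW.
    apply: (@mulIf _ (x i 0)); first by rewrite lt_eqF.
    by rewrite r2 ltr0_norm // mulrN mulNr.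
have Gx : P12 (bbG A (sign_partition x)) (lambda, b) by exists (lambda, b, x).
have pK : calK lambda b A (sign_partition x) by [].
split=> //; split=> //; right; apply: contrapT => deficient.
have [i|x' x'x sx'] := system_move pI sx _ deficient.
  by rewrite finset.inE.
by apply: x'x; apply: uniq; rewrite (solS_piece l0 pK).
Qed.

(** Where [x i 0] is nonzero, the point of the segment at a small distance [t] from [x]
    has an [i]th entry of the same sign, so its residual is extreme in the
    direction [i]; being an average of two residuals bounded by [lambda] and
    [lambda'], both must be extreme. *)
Lemma segment_certificate (lambda lambda' : R) (b b' : 'cV[R]_m) (x x' : 'cV[R]_n) :
  0 < lambda -> 0 < lambda' -> solS lambda b A x -> solS lambda' b' A x' ->
  (forall theta, 0 < theta -> theta < 1 ->
    solS (theta * lambda + (1 - theta) * lambda')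
      (theta *: b + (1 - theta) *: b') A (theta *: x + (1 - theta) *: x')) ->
  certificate A x (lambda'^-1 *: (b' - A *m x')).
Proof.
move=> lpos lpos' xS xS' seg i.
have [r1 _] := solS_kkt lpos xS i; have [r1' _] := solS_kkt lpos' xS' i.
rewrite coldotZ normrM gtr0_norm ?invr_gt0 // ler_pdivrMl // mulr1; split=> //.
set u := coldot A i (b - A *m x) in r1; set u' := coldot A i (b' - A *m x') in r1' *.
have [->|xn0] := eqVneq (x i 0) 0; first by rewrite mulr0 normr0.
have x0 : 0 < `|x i 0| by rewrite normr_gt0.
(* With this t the ith entry moves by at most half of its absolute value. *)
pose t := `|x i 0| / (2 * (`|x i 0| + `|x' i 0|)).
have s0 : 0 < 2 * (`|x i 0| + `|x' i 0|) by have := normr_ge0 (x' i 0); lra.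
have t0 : 0 < t by rewrite divr_gt0.
have t1 : t < 1 by rewrite ltr_pdivrMr // mul1r; have := normr_ge0 (x' i 0); lra.
have tE : t * (2 * (`|x i 0| + `|x' i 0|)) = `|x i 0|.
  by rewrite /t mulfVK // gt_eqF.
have t1' : 0 < 1 - t by lra.
have lt0 : 0 < (1 - t) * lambda + t * lambda' by rewrite addr_gt0 // mulr_gt0.
have := seg (1 - t) t1'; rewrite subKr gtrBl => /(_ t0).
move=> /(solS_kkt lt0)/(_ i)[_].
have -> : coldot A i ((1 - t) *: b + t *: b' - A *m ((1 - t) *: x + t *: x')) =
    (1 - t) * u + t * u'.
  rewrite /u /u' -!coldotZ -coldotD; congr coldot.
  by rewrite mulmxDr -!scalemxAr !scalerBr opprD addrACA.
rewrite !mxE => kkt.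
have du : (1 - t) * `|u| <= (1 - t) * lambda by rewrite ler_pM2l.
have du' : t * `|u'| <= t * lambda' by rewrite ler_pM2l.
suff -> : u' = lambda' * Num.sg (x i 0).
  by rewrite mulKf ?gt_eqF // -normrEsg.
have xx' : t * `|x' i 0| + t * `|x i 0| = `|x i 0| / 2 by lra.
have dx' : `|t * x' i 0| = t * `|x' i 0| by rewrite normrM gtr0_norm.
apply: (mulfI (lt0r_neq0 t0)).
move: (xn0); rewrite neq_lt => /orP[xneg|xpos].
  rewrite (ltr0_norm xneg) in xx'; rewrite ltr0_sg //.
  have := ler_norm (t * x' i 0); rewrite dx' => hx'.
  have Xneg : (1 - t) * x i 0 + t * x' i 0 < 0 by lra.
  move: kkt; rewrite (ltr0_norm Xneg) mulrN -mulNr.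
  move=> /(mulIf (ltr0_neq0 Xneg)).
  have := ler_norm (- u); have := ler_norm (- u'); rewrite !normrN => nu' nu.
  have nu1 : (1 - t) * - u <= (1 - t) * `|u| by rewrite ler_pM2l.
  have nu2 : t * - u' <= t * `|u'| by rewrite ler_pM2l.
  lra.
rewrite (gtr0_norm xpos) in xx'; rewrite gtr0_sg //.
have := ler_norm (- (t * x' i 0)); rewrite normrN dx' => hx'.
have Xpos : 0 < (1 - t) * x i 0 + t * x' i 0 by lra.
move: kkt; rewrite (gtr0_norm Xpos).
move=> /(mulIf (lt0r_neq0 Xpos)).
have nu1 : (1 - t) * u <= (1 - t) * `|u| by rewrite ler_pM2l // ler_norm.
have nu2 : t * u' <= t * `|u'| by rewrite ler_pM2l // ler_norm.
lra.
Qed.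

Lemma solS_strict_point p lambda b x z : calJ A p -> 0 < lambda ->
  strict_point A p lambda b z -> solS lambda b A x ->
  [/\ A *m x = A *m z, certificate A x (lambda^-1 *: (b - A *m z)) &
    certificate A z (lambda^-1 *: (b - A *m z))].
Proof.
move=> [pI _] lpos /(strict_point_system) sz xS.
have cz := system_certificate pI lpos sz.
move: xS; rewrite (solS_certificate (ltW lpos) cz) => [[]//|i].
by rewrite coldotZ mulVKf // gt_eqF.
Qed.

(** The multiplier of the second end certifies [x], hence also the solution [w] with
    full sign pattern at the first end; so it is extreme on all active indices of
    [p].  By strictness at the second end it is extreme only on those of [q]. *)
Lemma segment_subpartition p q (lambda lambda' : R) (b b' : 'cV[R]_m)
    (x x' : 'cV[R]_n) :
  calJ A p -> calJ A q ->
  solS lambda b A x -> solS lambda' b' A x' ->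
  interior (P12 (bbG A p)) (lambda, b) ->
  interior (P12 (bbG A q)) (lambda', b') ->
  (forall theta, 0 < theta -> theta < 1 ->
    solS (theta * lambda + (1 - theta) * lambda')
      (theta *: b + (1 - theta) *: b') A (theta *: x + (1 - theta) *: x')) ->
  Ipos p \subset Ipos q /\ Ineg p \subset Ineg q.
Proof.
move=> pJ qJ xS xS' zint zint' seg.
have [lpos [w sw]] := interior_strict_point pJ zint.
have [lpos' [w' sw']] := interior_strict_point qJ zint'.
have cx := segment_certificate lpos lpos' xS xS' seg.
have [Axw cxr cwr] := solS_strict_point pJ lpos sw xS.
have [Axw' _ _] := solS_strict_point qJ lpos' sw' xS'.
have cw := certificate_transfer Axw cxr cwr cx.
have [sp sz sn] := sw; have [sp' sz' sn'] := sw'; have [qI _] := qJ.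
split; apply/fintype.subsetP => i ii; have := cw i; rewrite Axw' coldotZ => -[_].
  have [wi _] := sp i ii; rewrite gtr0_norm // -[RHS]mul1r.
  move=> /(mulIf (lt0r_neq0 wi)) u1.
  have {u1} : coldot A i (b' - A *m w') = lambda'.
    by rewrite -[RHS]mulr1 -u1 mulVKf // gt_eqF.
  case: (calI_cases qI i) => -[-> iz iN] // ri.
    by have [_] := sz' i iz; rewrite ri gtr0_norm // ltxx.
  by have [_] := sn' i iN; rewrite ri; lra.
have [wi _] := sn i ii; rewrite ltr0_norm // -mulN1r.
move=> /(mulIf (ltr0_neq0 wi)) u1.
have {u1} : coldot A i (b' - A *m w') = - lambda'.
  by rewrite -[RHS]mulrN1 -u1 mulVKf // gt_eqF.
case: (calI_cases qI i) => -[ip iz ->] // ri.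
  by have [_] := sp' i ip; rewrite ri; lra.
by have [_] := sz' i iz; rewrite ri normrN gtr0_norm // ltxx.
Qed.

Lemma calI_eq (p q : index_triple n) : calI p -> calI q ->
  Ipos p = Ipos q -> Ineg p = Ineg q -> p = q.
Proof.
move=> pI qI Ep En.
have Ez : Izero p = Izero q.
  apply/finset.setP => i; case: (calI_cases pI i) (calI_cases qI i) => -[];
    by rewrite Ep En => ip iz iN; case=> -[]; rewrite ip iN iz.
by case: p q Ep En Ez {pI qI} => [? ? ?] [? ? ?] /= -> -> ->.
Qed.

Lemma segment_leaves_graph (p q : index_triple n) :
  calJ A p -> calJ A q -> p <> q ->
  forall (lambda lambda' : R) (b b' : 'cV[R]_m) (x x' : 'cV[R]_n),
  gph (solS_slice A) (lambda, b, x) ->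
  gph (solS_slice A) (lambda', b', x') ->
  interior (P12 (bbG A p)) (lambda, b) ->
  interior (P12 (bbG A q)) (lambda', b') ->
  exists theta : R, [/\ 0 < theta, theta < 1 &
    ~ gph (solS_slice A)
        (theta *: (lambda, b, x) + (1 - theta) *: (lambda', b', x'))].
Proof.
move=> pJ qJ pq lambda lambda' b b' x x' xS xS' zint zint'.
apply: contrapT => none; apply: pq.
have seg theta : 0 < theta -> theta < 1 ->
    solS (theta * lambda + (1 - theta) * lambda')
      (theta *: b + (1 - theta) *: b') A (theta *: x + (1 - theta) *: x').
  by move=> t0 t1; apply: contrapT => nS; apply: none; exists theta.
have [pq1 pq2] := segment_subpartition pJ qJ xS xS' zint zint' seg.
have [|qp1 qp2] := segment_subpartition qJ pJ xS' xS zint' zint.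
  move=> theta t0 t1; have := seg (1 - theta); rewrite subKr.
  rewrite [_ * lambda + _]addrC [_ *: b + _]addrC [_ *: x + _]addrC.
  by apply; lra.
case: (pJ) (qJ) => pI _ [qI _]; apply: calI_eq => //; apply/eqP;
  by rewrite finset.eqEsubset; apply/andP.
Qed.

End Main.

Theorem corollary3p2 (R : realType) (m n : nat) (A : 'M[R]_(m, n)) :
  [/\ (forall (lambda : R) (b : 'cV[R]_m) (p : index_triple n),
        0 <= lambda -> calK lambda b A p ->
        solS lambda b A =
        [set x : 'cV[R]_n |
          [/\ forall i, i \in Ipos p ->
                0 <= x i 0 /\ coldot A i (b - A *m x) = lambda,
              forall i, i \in Izero p ->
                x i 0 = 0 /\ `|coldot A i (b - A *m x)| <= lambda &
              forall i, i \in Ineg p ->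
                x i 0 <= 0 /\ coldot A i (b - A *m x) = - lambda]]),
      ((forall p : index_triple n, calJ0 A p ->
          [/\ single_valued_on (solS_slice A) (P12 (bbG A p)),
              linear_on (solS_slice A) (P12 (bbG A p)) &
              forall (lambda : R) (b : 'cV[R]_m),
                P12 (bbG A p) (lambda, b) ->
                exists x : 'cV[R]_n,
                  solS lambda b A = [set x] /\
                  unique (linear_system A p lambda b) x])
        /\
        (forall p : index_triple n, (calJ A `\` calJ0 A) p ->
          interior (P12 (bbG A p)) !=set0 /\
          forall z : R * 'cV[R]_m, interior (P12 (bbG A p)) z ->
            ~ single_valued_at (solS_slice A) z)),
      (forall (lambda : R) (b : 'cV[R]_m) (x : 'cV[R]_n),
        solS lambda b A = [set x] ->
        (calK lambda b A `&` calJ0 A) (sign_partition x)) &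
      (forall p q : index_triple n, calJ A p -> calJ A q -> p <> q ->
        forall (lambda lambda' : R) (b b' : 'cV[R]_m) (x x' : 'cV[R]_n),
        gph (solS_slice A) (lambda, b, x) ->
        gph (solS_slice A) (lambda', b', x') ->
        interior (P12 (bbG A p)) (lambda, b) ->
        interior (P12 (bbG A q)) (lambda', b') ->
        exists theta : R, [/\ 0 < theta, theta < 1 &
          ~ gph (solS_slice A)
              (theta *: (lambda, b, x) + (1 - theta) *: (lambda', b', x'))])].
Proof.
split.
- by move=> lambda b p; exact: solS_piece.
- split; [exact: full_rank_piece|exact: deficient_piece].
- exact: unique_sign_partition.
- exact: segment_leaves_graph.
Qed.
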